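(* Let $q,z$ be complex numbers with $0<|q|<1$, $z\neq 0$, and $z\ne q^{m}$ for every nonzero integer $m$. For every integer $k\geq 2$, \begin{align*} &(zq, z^{-1}q,q;q)_{\infty}\sum_{n=0}^{\infty}\frac{(q;q)_{2n}q^n}{(zq;q)_n(z^{-1}q;q)_n}\sum_{n_1,\ldots,n_{k-1}=0}^{\infty}\frac{q^{N_1^2+\cdots+N_{k-2}^2+2N_{k-1}^2+N_1+\cdots+N_{k-2}}}{(q;q)_{n-N_1}(q;q)_{n_1}\cdots(q;q)_{n_{k-2}}(q;q)_{2n_{k-1}}}\\ &=\sum_{n=0}^{\infty}\ \sum_{0\leq j<n/3}(-1)^{n+j}(z^{n-3j}+z^{3j-n})q^{\frac{1}{2}(n^2-3j^2)+\frac{1}{2}(n-j)+3(k-1)j(3j+1)}\\ &\quad+\sum_{n=0}^{\infty}\ \sum_{1\leq j<(n+1)/3}(-1)^{n+j}(z^{n-3j+1}+z^{3j-n-1})q^{\frac{1}{2}(n^2-3j^2)+\frac{1}{2}(n+j)+3(k-1)j(3j-1)}\\ &\quad +\sum_{j=0}^{\infty}q^{(3k-2)j(3j+1)}-\sum_{j=1}^{\infty}q^{(3k-2)j(3j-1)}, \end{align*} where $N_j=n_j+n_{j+1}+\cdots+n_{k-1}$ for $1\le j\le k-1$.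
   Context: Notation: $(a;q)_\infty=\prod_{n=0}^\infty(1-aq^n)$, $(a;q)_n=\dfrac{(a;q)_\infty}{(aq^n;q)_\infty}$ (so $(a;q)_n=\prod_{i=0}^{n-1}(1-aq^i)$ for $n\ge 0$), and $(a_1,\ldots,a_k;q)_\infty=(a_1;q)_\infty\cdots(a_k;q)_\infty$. As usual $1/(q;q)_{n}=0$ for negative integers $n$, so only terms with $N_1\le n$ contribute to the inner multiple sum. When $k=2$, the expressions $N_1^2+\cdots+N_{k-2}^2$ and $N_1+\cdots+N_{k-2}$ are empty (equal to $0$) and the product $(q;q)_{n_1}\cdots(q;q)_{n_{k-2}}$ is empty (equal to $1$). *)

(* Defs.v *)
From HB Require Import structures.
From mathcomp Require Import all_boot all_order all_algebra complex.
From mathcomp Require Import all_classical all_reals all_analysis.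
Set Implicit Arguments.
Unset Strict Implicit.
Unset Printing Implicit Defensive.
Import Order.TTheory GRing.Theory Num.Theory.
Import numFieldNormedType.Exports.
Local Open Scope classical_set_scope.
Local Open Scope ring_scope.

(* The library puts no topology on R[i] itself; stating the analytic notions  *)
(* over an abstract numFieldType C gives them the topology of the norm, and   *)
(* they can then be applied with C := R[i].                                   *)

Definition summable_from (C : numFieldType) (m : nat) (u : nat -> C) : Prop :=
  cvgn (fun N => \sum_(m <= n < N) u n).

Definition sum_from (C : numFieldType) (m : nat) (u : nat -> C) : C :=
  limn (fun N => \sum_(m <= n < N) u n).

Definition qpoch (C : numFieldType) (a q : C) (n : nat) : C :=
  \prod_(0 <= i < n) (1 - a * q ^+ i).

Definition qpoch_inf (C : numFieldType) (a q : C) : C := limn (qpoch a q).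

(* 1 / (q; q)_m for an integer m, which is 0 when m is negative. *)
Definition inv_qfact (C : numFieldType) (q : C) (m : int) : C :=
  if m is Posz n then (qpoch q q n)^-1 else 0.

(* A tuple v of length k - 1 stores (n_1, ..., n_(k-1)), numbered from 1. *)
Definition nidx (k : nat) (v : k.-1.-tuple nat) (i : nat) : nat :=
  nth 0%N v i.-1.

Definition Nidx (k : nat) (v : k.-1.-tuple nat) (j : nat) : nat :=
  \sum_(j <= i < k) nidx v i.

Definition multisum_exponent (k : nat) (v : k.-1.-tuple nat) : nat :=
  (\sum_(1 <= j < k.-1) Nidx v j ^ 2 + 2 * Nidx v k.-1 ^ 2
   + \sum_(1 <= j < k.-1) Nidx v j)%N.

Definition multisum_term (C : numFieldType) (k : nat) (q : C) (n : nat)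
    (v : k.-1.-tuple nat) : C :=
  q ^+ multisum_exponent v
  * inv_qfact q (n%:Z - (Nidx v 1)%:Z)
  / (\prod_(1 <= i < k.-1) qpoch q q (nidx v i)
     * qpoch q q (2 * nidx v k.-1)).

(* Finitely supported sum over all of nat^(k-1): a term with N_1 > n is 0,    *)
(* and each n_i is at most N_1.                                               *)
Definition multisum (C : numFieldType) (k : nat) (q : C) (n : nat) : C :=
  \sum_(v \in [set: k.-1.-tuple nat]) multisum_term q n v.

Definition lhs_term (C : numFieldType) (k : nat) (q z : C) (n : nat) : C :=
  qpoch q q (2 * n) * q ^+ n / (qpoch (z * q) q n * qpoch (z^-1 * q) q n)
  * multisum k q n.

(* The two half-integers of the exponent of q are added before halving: their *)
(* sum is an integer, and the natural subtractions do not truncate in the     *)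
(* range 3 j < n of the sum (resp. 1 <= j, 3 j < n + 1 in rhs_term2).         *)
Definition rhs_term1 (C : numFieldType) (k : nat) (q z : C) (n : nat) : C :=
  \sum_(0 <= j < n | (3 * j < n)%N)
    (-1) ^+ (n + j)
    * (z ^ (n%:Z - 3%:Z * j%:Z) + z ^ (3%:Z * j%:Z - n%:Z))
    * q ^+ ((n ^ 2 - 3 * j ^ 2 + (n - j))./2
            + 3 * (k - 1) * j * (3 * j + 1))%N.

Definition rhs_term2 (C : numFieldType) (k : nat) (q z : C) (n : nat) : C :=
  \sum_(1 <= j < n.+1 | (3 * j < n + 1)%N)
    (-1) ^+ (n + j)
    * (z ^ (n%:Z - 3%:Z * j%:Z + 1) + z ^ (3%:Z * j%:Z - n%:Z - 1))
    * q ^+ ((n ^ 2 - 3 * j ^ 2 + (n + j))./2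
            + 3 * (k - 1) * j * (3 * j - 1))%N.

Definition rhs_term3 (C : numFieldType) (k : nat) (q : C) (j : nat) : C :=
  q ^+ ((3 * k - 2) * j * (3 * j + 1))%N.

Definition rhs_term4 (C : numFieldType) (k : nat) (q : C) (j : nat) : C :=
  q ^+ ((3 * k - 2) * j * (3 * j - 1))%N.

(* Main.v *)
(**
Write [K n r = 1 / ((q)_(n-r) (q)_(n+r+1))].  One of Slater's Bailey pairs
relative to [a = q] expands [q^(n^2-n) / (q)_(2n)] along [K n r], with [r] in
[{3j} U {3j-1}]; it is proved by playing the two [q]-Pascal rules against each
other.  The case [a = q] of Bailey's lemma multiplies the coefficient of
[K n r] by [q^(r^2+r)] at each step, so [k-1] steps give the inner multiple sum.

It remains to sum [(q)_(2n) q^n / ((zq)_n (q/z)_n) * K n r] over [n].  Let [S r]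
be [1 - q^(2r+1)] times this sum, times the product [(zq, q/z, q)_oo].  Then
[S r] and the partial theta series
  [T r = q^r + sum_(m >= 1) (-1)^m (z^m + z^-m) q^(r + mr + m(m+1)/2)]
satisfy the same recurrence
  [q^(2r+1) S(r+2) + (z + 1/z) q^r S(r+1) + S r = q^r (1 - q^(2r+3))],
the first because its summands telescope in [n], the second termwise.  Both
are bounded, and the homogeneous recurrence has no nonzero bounded solution
because its coefficients tend to 0; hence [S = T].  Substituting and regrouping
the double series (Tannery's theorem) along [n = m + 3j] and [n = m + 3j - 1]
gives the right-hand side.
*)

Require Import Defs.
From mathcomp Require Import all_boot all_order all_algebra complex.
From mathcomp Require Import all_classical all_reals all_analysis.
From mathcomp Require Import ring lra zify.
Set Implicit Arguments.
Unset Strict Implicit.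
Unset Printing Implicit Defensive.
Import Order.TTheory GRing.Theory Num.Theory.
Import numFieldNormedType.Exports.
Local Open Scope classical_set_scope.
Local Open Scope ring_scope.

(** * Slater's Bailey pair *)

Lemma qpochS (C : numFieldType) (a q : C) n :
  qpoch a q n.+1 = qpoch a q n * (1 - a * q ^+ n).
Proof. by rewrite /qpoch big_nat_recr. Qed.

Lemma qpoch_neq0 (C : numFieldType) (a q : C) n :
  (forall i, a * q ^+ i != 1) -> qpoch a q n != 0.
Proof.
move=> ha; elim: n => [|n IH]; first by rewrite /qpoch big_geq ?oner_eq0.
by rewrite qpochS mulf_neq0 // subr_eq0 eq_sym.
Qed.

Section SlaterPair.
Variables (C : numFieldType) (q : C).
Hypotheses (q_neq0 : q != 0) (q_tors : forall i, q ^+ i.+1 != 1).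

Local Notation qfact := (qpoch q q).
Local Notation ifact := (inv_qfact q).

Lemma qfactS n : qfact n.+1 = qfact n * (1 - q ^+ n.+1).
Proof. by rewrite qpochS exprS. Qed.

Lemma qfact0 : qfact 0 = 1.
Proof. by rewrite /qpoch big_geq. Qed.

Lemma qfact_neq0 n : qfact n != 0.
Proof. by apply: qpoch_neq0 => i; rewrite -exprS. Qed.

Lemma ifact_neg (m : int) : m < 0 -> ifact m = 0.
Proof. by case: m. Qed.

(** At [m = 0] both sides vanish, and so they do for negative [m]. Holding on all integers, the rule
    spares every later manipulation of kernels a case split on signs. *)
Lemma ifact_pred (m : int) : ifact (m - 1) = ifact m * (1 - q ^ m).
Proof.
case: m => [[|n]|n]; first by rewrite expr0z subrr mulr0.
  have -> : Posz n.+1 - 1 = n by lia.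
  rewrite /= qfactS invfM -exprnP mulfVK //.
  by rewrite subr_eq0 eq_sym.
by rewrite !ifact_neg ?mul0r //; lia.
Qed.

(* Locked so that rewriting with [mulrA] cannot unfold it. *)
Definition qbin (L : nat) (k : int) : C :=
  locked (qfact L * ifact k * ifact (L%:Z - k)).

Lemma qbinE L k : qbin L k = qfact L * ifact k * ifact (L%:Z - k).
Proof. by rewrite /qbin -lock. Qed.

Lemma qbin_sym L k : qbin L (L%:Z - k) = qbin L k.
Proof. by rewrite !qbinE subKr mulrAC. Qed.

Lemma qbin_lt0 L (k : int) : k < 0 -> qbin L k = 0.
Proof. by move=> k0; rewrite !qbinE (ifact_neg k0) mulr0 mul0r. Qed.

Lemma qbin_gt L (k : int) : L%:Z < k -> qbin L k = 0.
Proof. by move=> k0; rewrite -qbin_sym qbin_lt0 // subr_lt0. Qed.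

Lemma qbin_pascal1 L (k : int) :
  qbin L.+1 k = qbin L k + q ^ (L.+1%:Z - k) * qbin L (k - 1).
Proof.
rewrite !qbinE ifact_pred qfactS.
have -> : L%:Z - k = (L.+1%:Z - k) - 1 by lia.
rewrite ifact_pred.
have -> : L%:Z - (k - 1) = L.+1%:Z - k by lia.
have -> : q ^+ L.+1 = q ^ (L.+1%:Z - k) * q ^ k.
  by rewrite -expfzDr // subrK -exprnP.
ring.
Qed.

Lemma qbin_pascal2 L (k : int) :
  qbin L.+1 k = q ^ k * qbin L k + qbin L (k - 1).
Proof.
rewrite -qbin_sym qbin_pascal1 addrC subKr; congr (_ * _ + _).
  by rewrite -[RHS]qbin_sym; congr qbin; lia.
by rewrite -[RHS]qbin_sym; congr qbin; lia.
Qed.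

(* The sum over all integers [j] with [|j| <= N]. *)
Definition zsum (N : nat) (f : int -> C) : C :=
  f 0 + \sum_(1 <= i < N.+1) (f i%:Z + f (- i%:Z)).

Lemma eq_zsum N f g : f =1 g -> zsum N f = zsum N g.
Proof.
by move=> fg; rewrite /zsum fg; congr (_ + _); apply: eq_bigr => i _; rewrite !fg.
Qed.

Lemma zsumB N f g : zsum N (fun j => f j - g j) = zsum N f - zsum N g.
Proof.
rewrite /zsum opprD addrACA; congr (_ + _).
by rewrite -sumrB; apply: eq_bigr => i _; ring.
Qed.

Lemma zsumZ N a f : zsum N (fun j => a * f j) = a * zsum N f.
Proof.
rewrite /zsum mulrDr mulr_sumr; congr (_ + _).
by apply: eq_bigr => i _; rewrite mulrDr.
Qed.

Lemma zsum_opp N f : zsum N (fun j => f (- j)) = zsum N f.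
Proof.
by rewrite /zsum oppr0; congr (_ + _); apply: eq_bigr => i _; rewrite opprK addrC.
Qed.

(** Shifting the window trades the end term at [- N] for the one at [N + 1]. The induction proves
    the version that keeps both; in the applications they are Gaussian binomials outside their
    range. *)
Lemma zsum_shift N f : f (- N%:Z) = 0 -> f (N%:Z + 1) = 0 ->
  zsum N (fun j => f (j + 1)) = zsum N f.
Proof.
suff: zsum N (fun j => f (j + 1)) + f (- N%:Z) = zsum N f + f (N%:Z + 1).
  by move=> H f1 f2; move: H; rewrite f1 f2 !addr0.
elim: N => [|N IH]; first by rewrite /zsum !big_geq // oppr0 !addr0 add0r addrC.
have zS g : zsum N.+1 g = zsum N g + (g N.+1%:Z + g (- N.+1%:Z)).
  by rewrite /zsum big_nat_recr //= addrA.
rewrite !zS; have -> : - N.+1%:Z + 1 = - N%:Z by lia.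
have -> : N.+1%:Z = N%:Z + 1 by lia.
by rewrite [zsum N (fun _ => _) + _]addrCA IH; ring.
Qed.

(* Up to the factor [(q)_(2m+2)], [Xsum] is the Slater expansion at [n = m + 1];
   [Ysum] and [Zsum] are the intermediate forms reached by Pascal's rule. *)
Definition Xsum N m : C := zsum N (fun j => q ^ (3 * j * j - 2 * j)
    * qbin (2 * m).+2 (m%:Z + 1 - 3 * j)
  - q ^ (3 * j * j + 4 * j + 1) * qbin (2 * m).+2 (m%:Z - 3 * j)).

Definition Ysum N m : C := zsum N (fun j => q ^ (3 * j * j - 2 * j)
    * qbin (2 * m).+1 (m%:Z + 1 - 3 * j)
  - q ^ (3 * j * j + 4 * j + 1) * qbin (2 * m).+1 (m%:Z - 1 - 3 * j)).

Definition Zsum N m : C := zsum N (fun j => q ^ (3 * j * j + j)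
    * (qbin (2 * m) (m%:Z - 3 * j) - qbin (2 * m) (m%:Z - 1 - 3 * j))).

(** The first Pascal rule on one binomial and the second on the other both leave a multiple of
    [qbin (2 * m).+1 (m - 3 * j)], with the same power [3j^2 + j + m + 1] of [q], and these
    cancel. *)
Lemma Xsum_Ysum N m : Xsum N m = Ysum N m.
Proof.
apply: eq_zsum => j; rewrite qbin_pascal1 [qbin _ (m%:Z - 3 * j)]qbin_pascal2.
have -> : m%:Z + 1 - 3 * j - 1 = m%:Z - 3 * j by lia.
have -> : m%:Z - 3 * j - 1 = m%:Z - 1 - 3 * j by lia.
rewrite !mulrDr !mulrA -!expfzDr //.
set a := (X in q ^ X * qbin _ (m%:Z - 3 * j)).
set b := (X in _ - (q ^ X * _ + _)).
have -> : a = b by rewrite /a /b; lia.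
ring.
Qed.

(** The reflection [j -> - j], the symmetry of the binomials and, in the second term, a shift of [j]
    give both terms the common power [3j^2 + 2j]. Pascal's rules then cancel
    [qbin (2 * m) (m - 1 - 3 * j)], and a second reflection brings out [q ^+ m]. The bound [m <= N]
    makes the end terms of the shifts vanish. *)
Lemma Ysum_Zsum N m : (m <= N)%N -> Ysum N m = q ^+ m * Zsum N m.
Proof.
move=> mN; transitivity (zsum N (fun j => q ^ (3 * j * j + 2 * j)
    * (qbin (2 * m).+1 (m%:Z - 3 * j) - qbin (2 * m).+1 (m%:Z - 1 - 3 * j)))).
  under [RHS]eq_zsum => j do rewrite mulrBr.
  rewrite /Ysum !zsumB; congr (_ - _).
    rewrite -[LHS]zsum_opp; apply: eq_zsum => j; rewrite -[in RHS]qbin_sym.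
    by congr (q ^ _ * qbin _ _); lia.
  rewrite -[LHS]zsum_opp -[LHS]zsum_shift.
  - apply: eq_zsum => j; rewrite -[in RHS]qbin_sym.
    by congr (q ^ _ * qbin _ _); lia.
  - by rewrite qbin_lt0 ?mulr0 //; lia.
  - by rewrite qbin_gt ?mulr0 //; lia.
rewrite /Zsum -zsumZ.
under [RHS]eq_zsum => j do rewrite mulrCA !mulrBr.
transitivity (zsum N (fun j => q ^ (3 * j * j + 2 * j)
    * (q ^ (m%:Z - 3 * j) * qbin (2 * m) (m%:Z - 3 * j)
    - q ^ (m%:Z + 2 + 3 * j) * qbin (2 * m) (m%:Z - 2 - 3 * j)))).
  apply: eq_zsum => j; rewrite qbin_pascal2 [qbin _ (m%:Z - 1 - 3 * j)]qbin_pascal1.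
  have -> : m%:Z - 1 - 3 * j - 1 = m%:Z - 2 - 3 * j by lia.
  have -> : m%:Z - 3 * j - 1 = m%:Z - 1 - 3 * j by lia.
  have -> : (2 * m).+1%:Z - (m%:Z - 1 - 3 * j) = m%:Z + 2 + 3 * j by lia.
  by congr (_ * _); ring.
under eq_zsum => j do rewrite mulrBr !mulrA -!expfzDr //.
rewrite exprnP !zsumB; congr (_ - _).
  rewrite -[LHS]zsum_opp; apply: eq_zsum => j; rewrite -[in RHS]qbin_sym.
  by rewrite mulrA -expfzDr //; congr (q ^ _ * qbin _ _); lia.
rewrite -[LHS]zsum_opp -[LHS]zsum_shift.
- apply: eq_zsum => j; rewrite -[in RHS]qbin_sym.
  by rewrite mulrA -expfzDr //; congr (q ^ _ * qbin _ _); lia.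
- by rewrite qbin_lt0 ?mulr0 //; lia.
- by rewrite qbin_gt ?mulr0 //; lia.
Qed.

Lemma ZsumS N m : Zsum N m.+1 = q ^+ m.+1 * Ysum N m.
Proof.
rewrite /Ysum -zsumZ; apply: eq_zsum => j.
have -> : (2 * m.+1 = (2 * m).+2)%N by lia.
rewrite qbin_pascal2 [qbin _ (m.+1%:Z - 1 - 3 * j)]qbin_pascal1.
have -> : m.+1%:Z - 3 * j - 1 = m%:Z - 3 * j by lia.
have -> : m.+1%:Z - 1 - 3 * j = m%:Z - 3 * j by lia.
have -> : m%:Z - 3 * j - 1 = m%:Z - 1 - 3 * j by lia.
rewrite exprnP !mulrBr !mulrDr !mulrA -!expfzDr // opprD addrA addrK.
congr (_ - _).
  by congr (q ^ _ * qbin _ _); lia.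
by congr (q ^ _ * qbin _ _); lia.
Qed.

(** The two preceding relations combine to [Zsum (m + 1) = q^(2m+1) Zsum m]; at [m = 0] only the
    term [j = 0] survives. *)
Lemma ZsumE N m : (m <= N)%N -> Zsum N m = q ^+ (m ^ 2).
Proof.
elim: m => [|m IH] mN; last first.
  rewrite ZsumS Ysum_Zsum ?IH ?(ltnW mN) // -!exprD; congr (_ ^+ _); lia.
rewrite /Zsum /zsum big_nat big1 => [|i /andP[i1 _]]; last first.
  rewrite [qbin _ (_ - _ * i%:Z)]qbin_lt0; last lia.
  rewrite [qbin _ (_ - 1 - _ * i%:Z)]qbin_lt0; last lia.
  rewrite [qbin _ (_ - _ * - i%:Z)]qbin_gt; last lia.
  by rewrite [qbin _ (_ - 1 - _)]qbin_gt ?subrr ?mulr0 ?addr0 //; lia.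
rewrite addr0 [qbin _ (_ - 1 - _)]qbin_lt0 // subr0 muln0 !mulr0 !subr0 qbinE /=.
by rewrite !qfact0 expr0z invr1 !mulr1 exp0n ?expr0.
Qed.

(* The usual kernel for [a = q] is [1 - q] times this one. *)
Definition bailey_kernel (n r : nat) : C := ifact (n%:Z - r%:Z) / qfact (n + r).+1.

Lemma bailey_kernel_lt n r : (n < r)%N -> bailey_kernel n r = 0.
Proof. by move=> nr; rewrite /bailey_kernel ifact_neg ?mul0r //; lia. Qed.

(** After extracting the common factor by [ifact_pred], the bracket is [(1 - q^(n+1+3j)) - q^(6j+1)
    (1 - q^(n-3j)) = 1 - q^(6j+1)]. *)
Lemma base_term n (j : int) :
  q ^ (3 * j * j - 2 * j) * (ifact (n%:Z - 3 * j) * ifact (n%:Z + 3 * j))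
    - q ^ (3 * j * j + 4 * j + 1)
      * (ifact (n%:Z - 1 - 3 * j) * ifact (n%:Z + 1 + 3 * j))
  = q ^ (3 * j * j - 2 * j) * (1 - q ^ (6 * j + 1))
    * (ifact (n%:Z - 3 * j) * ifact (n%:Z + 1 + 3 * j)).
Proof.
have -> : n%:Z + 3 * j = n%:Z + 1 + 3 * j - 1 by lia.
have -> : n%:Z - 1 - 3 * j = n%:Z - 3 * j - 1 by lia.
have -> : 3 * j * j + 4 * j + 1 = 3 * j * j - 2 * j + (6 * j + 1) by lia.
rewrite !ifact_pred [q ^ (_ + (6 * j + 1))]expfzDr //.
have -> : n%:Z + 1 + 3 * j = (n%:Z - 3 * j) + (6 * j + 1) by lia.
rewrite [q ^ (n%:Z - _ + _)]expfzDr //.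
ring.
Qed.

Lemma base_zsum n N : (n <= N)%N ->
  q ^+ (n ^ 2 - n) / qfact (2 * n) =
  zsum N (fun j => q ^ (3 * j * j - 2 * j) * (1 - q ^ (6 * j + 1))
    * (ifact (n%:Z - 3 * j) * ifact (n%:Z + 1 + 3 * j))).
Proof.
case: n => [|m] mN.
  (* [Xsum] only covers [n = m + 1]. At [n = 0] the single surviving term is [j = 0], equal to
     [(1 - q) / (q)_1 = 1]. *)
  rewrite /zsum big_nat big1 => [|i /andP[i1 _]]; last first.
    rewrite ifact_neg ?mul0r ?mulr0 ?add0r; last lia.
    by rewrite [ifact (_ + _)]ifact_neg ?mul0r ?mulr0 //; lia.
  rewrite !mulr0 subr0 !addr0 /= qfactS qfact0 expr0z expr1z !invr1 !mul1r.
  rewrite mulfV //.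
  by have := q_tors 0; rewrite expr1 subr_eq0 eq_sym.
transitivity (Xsum N m / qfact (2 * m).+2).
  rewrite Xsum_Ysum Ysum_Zsum ?ZsumE -?exprD; [|lia..].
  by congr (q ^+ _ / qfact _); lia.
under [RHS]eq_zsum => j do rewrite -base_term.
rewrite mulrC /Xsum -zsumZ; apply: eq_zsum => j.
rewrite !qbinE mulrBr; congr (_ - _); rewrite mulrCA; congr (_ * _).
  rewrite !mulrA mulVf ?mul1r ?qfact_neq0 //; congr (ifact _ * ifact _); lia.
rewrite !mulrA mulVf ?mul1r ?qfact_neq0 //; congr (ifact _ * ifact _); lia.
Qed.

(** The bilateral sum is folded: the index [- i] gives [r = 3i - 1], and
    [1 - q^(1-6i) = - q^(1-6i) (1 - q^(6i-1))] supplies the minus sign and the exponent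
    [3i^2 - 4i + 1]. Writing it as [3i^2 + 1 - 4i] avoids truncation at [i = 1]. *)
Lemma base_pair n N : (n <= N)%N ->
  q ^+ (n ^ 2 - n) / qfact (2 * n) =
  \sum_(0 <= j < N.+1) q ^+ (3 * j ^ 2 - 2 * j)
      * (1 - q ^+ (2 * (3 * j)).+1) * bailey_kernel n (3 * j)
  - \sum_(1 <= j < N.+1) q ^+ (3 * j ^ 2 + 1 - 4 * j)
      * (1 - q ^+ (2 * (3 * j - 1)).+1) * bailey_kernel n (3 * j - 1).
Proof.
move=> nN; rewrite (base_zsum nN) /zsum big_split /= addrA; congr (_ + _).
  rewrite [RHS]big_nat_recl // big_add1 succnK; congr (_ + _).
    by rewrite /bailey_kernel !muln0 !mulr0 !addn0 !addr0 addn1 expr0z expr1z.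
  apply: eq_big_nat => i _.
  by rewrite /bailey_kernel !exprnP /=; congr (q ^ _ * (1 - q ^ _) * (ifact _ / qfact _)); lia.
rewrite -sumrN; apply: eq_big_nat => i /andP[i1 _]; rewrite /bailey_kernel.
have -> : ifact (n%:Z + 1 + 3 * - i%:Z) = ifact (n%:Z - (3 * i - 1)%N%:Z).
  by congr ifact; lia.
have -> : n%:Z - 3 * - i%:Z = (n + (3 * i - 1)).+1 by lia.
rewrite /= -[RHS]mulNr -[in RHS]mulrN opprB !mulrBr !mulr1 -expfzDr // -exprD.
have i4 : (4 * i <= 3 * i ^ 2 + 1)%N by nia.
rewrite -mulnn in i4 *.
rewrite !exprnP; congr ((q ^ _ - q ^ _) * _); [nia..|exact: mulrC].
Qed.

End SlaterPair.

(** * The Bailey chain and the multiple sum *)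

Section BaileyChain.
Variables (C : numFieldType) (q : C).
Hypotheses (q_neq0 : q != 0) (q_tors : forall i, q ^+ i.+1 != 1).

Local Notation qfact := (qpoch q q).
Local Notation ifact := (inv_qfact q).
Local Notation kern := (bailey_kernel q).

Lemma ifact_nat (m n : nat) : (n <= m)%N -> ifact (m%:Z - n%:Z) = (qfact (m - n))^-1.
Proof. by move=> nm; rewrite subzn. Qed.

Lemma sum_shiftD (g h : nat -> C) N : g N.+1 = 0 -> h 0%N = 0 ->
  \sum_(0 <= i < N.+2) (g i + h i) = \sum_(0 <= i < N.+1) (g i + h i.+1).
Proof.
move=> g0 h0; rewrite big_split big_nat_recr //= [X in _ + X]big_nat_recl //.
by rewrite g0 h0 addr0 add0r -big_split.
Qed.

Definition chu_sum (N c : nat) : C :=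
  \sum_(0 <= i < N.+1) q ^+ (i * (i + c)) * ifact (N%:Z - i%:Z)
    / (qfact i * qfact (i + c)).

(* Together with [chu_sum 0 c = 1 / (q)_c], this is a proof of the
   [q]-Chu-Vandermonde sum by induction on [N] alone. *)
Lemma chu_sumS N c : (1 - q ^+ N.+1) * chu_sum N.+1 c = chu_sum N c.+1.
Proof.
(* The split is [1 - q^(N+1) = q^i (1 - q^(N+1-i)) + (1 - q^i)]: the first part lowers [N + 1 - i]
   and gives [g], the second lowers [i] and gives [h]. Shifting [h] by one puts both over
   [(q)_(i+c+1)]. *)
pose g i := q ^+ (i * (i + c).+1) * ifact (N%:Z - i%:Z) / (qfact i * qfact (i + c)).
pose h i := q ^+ (i * (i + c)) * ifact (N.+1%:Z - i%:Z) * ifact (i%:Z - 1)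
  / qfact (i + c).
transitivity (\sum_(0 <= i < N.+2) (g i + h i)).
  rewrite /chu_sum mulr_sumr; apply: eq_big_nat => i /andP[_ iN].
  rewrite /g /h; have -> : N%:Z - i%:Z = N.+1%:Z - i%:Z - 1 by lia.
  rewrite !ifact_pred // subzn // -!exprnP.
  have -> : q ^+ N.+1 = q ^+ (N.+1 - i) * q ^+ i by rewrite -exprD subnK.
  rewrite mulnS exprD /= invfM; ring.
have g0 : g N.+1 = 0 by rewrite /g ifact_neg ?mulr0 ?mul0r //; lia.
have h0 : h 0%N = 0 by rewrite /h [ifact (_ - 1)]ifact_neg ?mulr0 ?mul0r.
rewrite sum_shiftD //.
apply: eq_big_nat => i _; rewrite /g /h.
have -> : N.+1%:Z - i.+1%:Z = N%:Z - i%:Z by lia.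
have -> : i.+1%:Z - 1 = i by lia.
rewrite addSn addnS !qfactS !invfM.
have q1 : 1 - q ^+ (i + c).+1 != 0 by rewrite subr_eq0 eq_sym.
have -> : q ^+ (i.+1 * (i + c).+1) = q ^+ (i * (i + c).+1) * q ^+ (i + c).+1.
  by rewrite -exprD; congr (_ ^+ _); lia.
rewrite /=; field.
by rewrite q1 !qfact_neq0.
Qed.

Lemma chu_sumE N c : chu_sum N c = (qfact N * qfact (N + c))^-1.
Proof.
elim: N c => [|N IH] c.
  by rewrite /chu_sum big_nat1 mul0n expr0 subrr /= qfact0 invr1 mulr1 add0n mul1r.
have q1 : 1 - q ^+ N.+1 != 0 by rewrite subr_eq0 eq_sym.
apply: (mulfI q1); rewrite chu_sumS IH addnS -addSn [qfact N.+1]qfactS.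
by field; rewrite q1 !qfact_neq0.
Qed.

(** Bailey's lemma at [a = q], with both parameters sent to infinity, for a single kernel. Terms
    with [m < r] vanish; with [m = i + r] the exponent becomes [r^2 + r + i (i + 2r + 1)] and a
    [q]-Chu-Vandermonde sum with [c = 2r + 1] remains. *)
Lemma bailey_step n r :
  \sum_(0 <= m < n.+1) q ^+ (m ^ 2 + m) * ifact (n%:Z - m%:Z) * kern m r
  = q ^+ (r ^ 2 + r) * kern n r.
Proof.
have [nr|rn] := ltnP n r.
  rewrite bailey_kernel_lt // mulr0 big_nat big1 // => m /andP[_ mn].
  by rewrite bailey_kernel_lt ?mulr0 //; lia.
rewrite (big_cat_nat (n := r)) //=; last lia.
rewrite [X in X + _]big_nat big1 ?add0r; last first.
  by move=> m /andP[_ mr]; rewrite bailey_kernel_lt ?mulr0.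
rewrite -{1}[r]add0n big_addn subSn //.
transitivity (q ^+ (r ^ 2 + r) * chu_sum (n - r) (2 * r).+1); last first.
  rewrite chu_sumE /bailey_kernel ifact_nat //; congr (_ * _).
  by rewrite invfM; congr (_ / qfact _); lia.
rewrite /chu_sum mulr_sumr; apply: eq_big_nat => i /andP[_ ir].
rewrite /bailey_kernel; have -> : (i + r)%N%:Z - r%:Z = i by lia.
have -> : n%:Z - (i + r)%N%:Z = (n - r)%N%:Z - i%:Z by lia.
have -> : (i + r + r).+1 = (i + (2 * r).+1)%N by lia.
have -> : ((i + r) ^ 2 + (i + r) = r ^ 2 + r + i * (i + (2 * r).+1))%N by nia.
by rewrite exprD /= invfM; ring.
Qed.

Lemma bailey_chain_sum (I : Type) (s : seq I) (a : I -> C) (r : I -> nat) n :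
  \sum_(0 <= m < n.+1) q ^+ (m ^ 2 + m) * ifact (n%:Z - m%:Z)
    * (\sum_(i <- s) a i * kern m (r i))
  = \sum_(i <- s) q ^+ (r i ^ 2 + r i) * a i * kern n (r i).
Proof.
under eq_bigr => m _ do rewrite mulr_sumr.
rewrite exchange_big; apply: eq_bigr => i _.
rewrite [_ * a i]mulrC -mulrA -bailey_step mulr_sumr.
by apply: eq_bigr => m _; ring.
Qed.

(** * The multiple sum as an iterated Bailey chain *)

Lemma Nidx1 m (v : m.+1.-tuple nat) : @Nidx m.+2 v 1 = sumn v.
Proof.
rewrite /Nidx big_add1 /= sumnE [RHS](big_nth 0%N) size_tuple.
exact: eq_big_nat.
Qed.

Lemma Nidx_cons m x (v : m.+1.-tuple nat) j :
  @Nidx m.+3 (cons_tuple x v) j.+2 = @Nidx m.+2 v j.+1.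
Proof.
by rewrite /Nidx big_add1 /=; apply: eq_big_nat => -[|i] //.
Qed.

(** The tail is taken with [N] in place of [n]: its factor [1 / (q)_(N - sumn v)] is exactly the
    missing [1 / (q)_x] of the removed entry. *)
Lemma multisum_term_cons m n x (v : m.+1.-tuple nat) (N := (x + sumn v)%N) :
  @multisum_term C m.+3 q n (cons_tuple x v)
  = q ^+ (N ^ 2 + N) * ifact (n%:Z - N%:Z) * @multisum_term C m.+2 q N v.
Proof.
rewrite /multisum_term.
have -> : multisum_exponent (k := m.+3) (cons_tuple x v)
    = (N ^ 2 + N + multisum_exponent (k := m.+2) v)%N.
  rewrite /multisum_exponent /=.
  rewrite [(\sum_(1 <= j < m.+2) _ ^ 2)%N]big_nat_recl //
    [(\sum_(1 <= j < m.+2) _)%N]big_nat_recl //.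
  have sN : sumn (cons_tuple x v) = N by [].
  rewrite Nidx1 sN Nidx_cons.
  have Nc j : (1 <= j)%N ->
      @Nidx m.+3 (cons_tuple x v) j.+1 = @Nidx m.+2 v j.
    by case: j => // j _; rewrite Nidx_cons.
  rewrite (eq_big_nat _ _ (F2 := fun j => @Nidx m.+2 v j ^ 2)%N); last first.
    by move=> j /andP[j1 _]; rewrite Nc.
  rewrite [X in (_ + (_ + X))%N](eq_big_nat _ _ (F2 := @Nidx m.+2 v)); last first.
    by move=> j /andP[j1 _]; rewrite Nc.
  by clearbody N; lia.
rewrite !Nidx1 /= -/N; have -> : N%:Z - (sumn v)%:Z = x by lia.
rewrite big_nat_recl // (eq_big_nat _ _ (F2 := fun i => qfact (@nidx m.+2 v i))).
  2: by case.
rewrite exprD !invfM.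
have -> : nidx (k := m.+3) (cons_tuple x v) m.+2 = nidx (k := m.+2) v m.+1 by [].
rewrite {1}/nidx /=.
ring.
Qed.

(* The tuples with [N_1 <= n], enumerated by [N = N_1] and the tail. *)
Fixpoint bounded_tuples (m n : nat) : seq (m.+1.-tuple nat) :=
  match m with
  | 0 => [seq [tuple x] | x <- iota 0 n.+1]
  | m'.+1 => [seq cons_tuple (N - sumn v)%N v
               | N : nat <- iota 0 n.+1, v : m'.+1.-tuple nat <- bounded_tuples m' N]
  end.

Lemma bounded_tuples0 n :
  bounded_tuples 0 n = [seq [tuple x] | x <- iota 0 n.+1].
Proof. by []. Qed.

Lemma bounded_tuplesS m n : bounded_tuples m.+1 n =
  [seq cons_tuple (N - sumn v)%N v
    | N : nat <- iota 0 n.+1, v : m.+1.-tuple nat <- bounded_tuples m N].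
Proof. by []. Qed.

Lemma mem_bounded_tuples m n (v : m.+1.-tuple nat) :
  (v \in bounded_tuples m n) = (sumn v <= n)%N.
Proof.
elim: m n v => [|m IH] n v.
  case/tupleP: v => x v; rewrite [v]tuple0 [sumn _]addn0 bounded_tuples0.
  apply/mapP/idP => [[y]|xn]; first by rewrite mem_iota => yn [->].
  by exists x; [rewrite mem_iota | apply: val_inj].
case/tupleP: v => x v; rewrite bounded_tuplesS; apply/allpairsPdep/idP => [[N [w [Nn + e]]]|xn].
  rewrite IH e /= => wN; rewrite subnK //.
  by move: Nn; rewrite mem_iota.
exists (x + sumn v)%N, v; split; first by rewrite mem_iota.
  by rewrite IH leq_addl.
by rewrite addnK.
Qed.

Lemma bounded_tuples_uniq m n : uniq (bounded_tuples m n).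
Proof.
elim: m n => [|m IH] n.
  by rewrite bounded_tuples0 map_inj_uniq ?iota_uniq // => x y [].
rewrite bounded_tuplesS; apply: allpairs_uniq_dep; rewrite ?iota_uniq // => -[N v] [N' v'].
move=> /allpairsPdep[a [w [_ + [-> ->]]]] /allpairsPdep[a' [w' [_ + [-> ->]]]].
rewrite !mem_bounded_tuples /= => wa wa' [ea /val_inj ew].
by move: wa wa' ea; rewrite -{w'}ew => wa wa' ea; have -> : a = a' by lia.
Qed.

Lemma multisum_bounded m n :
  @multisum C m.+2 q n = \sum_(v <- bounded_tuples m n) @multisum_term C m.+2 q n v.
Proof.
rewrite fsbig_seq ?bounded_tuples_uniq //; apply/esym/fsbig_widen => // v [_ /= vn].
rewrite /multisum_term Nidx1 ifact_neg ?mulr0 ?mul0r //.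
by move: vn => /negP; rewrite mem_bounded_tuples; lia.
Qed.

(** Splitting [2m^2 = (m^2 + m) + (m^2 - m)] exhibits the case [k = 2] as one step of the chain
    applied to Slater's sequence. *)
Lemma multisum2 n : @multisum C 2 q n =
  \sum_(0 <= m < n.+1) q ^+ (m ^ 2 + m) * ifact (n%:Z - m%:Z)
    * (q ^+ (m ^ 2 - m) / qfact (2 * m)).
Proof.
rewrite multisum_bounded bounded_tuples0 big_map.
rewrite /index_iota subn0; apply: eq_bigr => x _.
rewrite /multisum_term Nidx1 /= addn0 big_geq // mul1r.
rewrite /multisum_exponent !big_geq // Nidx1 /= !addn0 add0n.
have -> : (2 * x ^ 2 = x ^ 2 + x + (x ^ 2 - x))%N by nia.
by rewrite exprD; ring.
Qed.

Lemma multisumS m n : @multisum C m.+3 q n =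
  \sum_(0 <= N < n.+1) q ^+ (N ^ 2 + N) * ifact (n%:Z - N%:Z)
    * @multisum C m.+2 q N.
Proof.
rewrite multisum_bounded bounded_tuplesS.
rewrite big_allpairs_dep /index_iota subn0; apply: eq_bigr => N _.
rewrite multisum_bounded mulr_sumr; apply: eq_big_seq => v.
rewrite mem_bounded_tuples => vN.
by rewrite multisum_term_cons subnK.
Qed.

(* The coefficients after [k] steps of the chain, for [r = 3j] and, with [j > 0],
   for [r = 3j - 1]. *)
Definition bailey_coef0 k j : C :=
  q ^+ (k * ((3 * j) ^ 2 + 3 * j) + (3 * j ^ 2 - 2 * j)).

Definition bailey_coef1 k j : C :=
  q ^+ (k * ((3 * j - 1) ^ 2 + (3 * j - 1)) + (3 * j ^ 2 + 1 - 4 * j)).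

(** The local [step] raises the number of chain steps by one; it starts from [base_pair] at zero
    steps. The cutoff [J] is left free so that one range of [j] serves all [n <= J], which later
    permits a finite exchange of sums. *)
Lemma multisumE m n J : (n <= J)%N -> @multisum C m.+2 q n =
  \sum_(0 <= j < J.+1) bailey_coef0 m.+1 j
      * (1 - q ^+ (2 * (3 * j)).+1) * kern n (3 * j)
  - \sum_(1 <= j < J.+1) bailey_coef1 m.+1 j
      * (1 - q ^+ (2 * (3 * j - 1)).+1) * kern n (3 * j - 1).
Proof.
have step k (b : nat -> C) : (forall n, (n <= J)%N -> b n =
    \sum_(0 <= j < J.+1) bailey_coef0 k j
      * (1 - q ^+ (2 * (3 * j)).+1) * kern n (3 * j)
    - \sum_(1 <= j < J.+1) bailey_coef1 k j
      * (1 - q ^+ (2 * (3 * j - 1)).+1) * kern n (3 * j - 1)) ->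
    forall n, (n <= J)%N ->
    \sum_(0 <= N < n.+1) q ^+ (N ^ 2 + N) * ifact (n%:Z - N%:Z) * b N =
    \sum_(0 <= j < J.+1) bailey_coef0 k.+1 j
      * (1 - q ^+ (2 * (3 * j)).+1) * kern n (3 * j)
    - \sum_(1 <= j < J.+1) bailey_coef1 k.+1 j
      * (1 - q ^+ (2 * (3 * j - 1)).+1) * kern n (3 * j - 1).
  move=> hb {}n nJ.
  transitivity (\sum_(0 <= N < n.+1) (
      q ^+ (N ^ 2 + N) * ifact (n%:Z - N%:Z) * (\sum_(0 <= j < J.+1)
        bailey_coef0 k j * (1 - q ^+ (2 * (3 * j)).+1) * kern N (3 * j))
    - q ^+ (N ^ 2 + N) * ifact (n%:Z - N%:Z) * (\sum_(1 <= j < J.+1)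
        bailey_coef1 k j * (1 - q ^+ (2 * (3 * j - 1)).+1) * kern N (3 * j - 1)))).
    by apply: eq_big_nat => N /andP[_ Nn]; rewrite hb ?mulrBr //; lia.
  rewrite sumrB !bailey_chain_sum; congr (_ - _); apply: eq_bigr => j _.
    by rewrite !mulrA /bailey_coef0 -exprD addnA -mulSn.
  by rewrite !mulrA /bailey_coef1 -exprD addnA -mulSn.
elim: m n => [|m IH] n nJ; last by rewrite multisumS; exact: (step m.+1).
by rewrite multisum2; apply: (step 0%N) => // N NJ; exact: base_pair.
Qed.

End BaileyChain.

(** * Sequences of complex numbers with geometric bounds *)

Section ComplexSequences.
Variable R : realType.
Local Notation C := (Num.NumField.sort (R[i] : numFieldType)).
Implicit Types (u v : nat -> C) (l : C).

(** Positive elements of [R[i]] are real, so real tolerances suffice. *)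
Lemma cvgCP u l : u @ \oo --> l <->
  (forall e : R, 0 < e -> exists N, forall n, (N <= n)%N -> `|l - u n| < e%:C%C).
Proof.
split=> [/cvgrPdist_lt h e e0|h].
  have e0' : 0 < e%:C%C :> C by rewrite ltcR.
  by have [N _ hN] := h _ e0'; exists N.
apply/cvgrPdist_lt => e e0.
have /complex_realP[x ex] : e \is Num.real by rewrite gtr0_real.
have x0 : 0 < x by rewrite -ltcR -ex.
by have [N hN] := h _ x0; exists N => // n; rewrite ex; apply: hN.
Qed.

Lemma limCE u l : u @ \oo --> l -> limn u = l.
Proof. by apply: cvg_lim; apply: norm_hausdorff. Qed.

Lemma cvgC_unique u l l' : u @ \oo --> l -> u @ \oo --> l' -> l = l'.
Proof. by move=> /limCE <- /limCE. Qed.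

Lemma cvgCD u v l l' : u @ \oo --> l -> v @ \oo --> l' ->
  (fun n => u n + v n) @ \oo --> (l + l' : C).
Proof. by move=> ul vl; apply: (cvgD ul vl). Qed.

Lemma cvgCM u v l l' : u @ \oo --> l -> v @ \oo --> l' ->
  (fun n => u n * v n) @ \oo --> (l * l' : C).
Proof. by move=> ul vl; apply: (cvgM ul vl). Qed.

Lemma cvgCMl (a : C) u l : u @ \oo --> l -> (fun n => a * u n) @ \oo --> (a * l : C).
Proof. by move=> ul; apply: (cvgCM (cvg_cst a) ul). Qed.

Lemma cvgCN u l : u @ \oo --> l -> (fun n => - u n) @ \oo --> (- l : C).
Proof. by move=> ul; apply: (cvgN ul). Qed.

Lemma cvgC_bounded u : cvgn u -> exists2 B : C, 0 <= B & forall n, `|u n| <= B.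
Proof.
move=> /cvg_seq_bounded/pinfty_ex_gt0[B B0 /= hB].
by exists B => [|n]; [exact: ltW | exact: hB].
Qed.

Lemma norm_lim_le u l (B : C) : u @ \oo --> l -> (forall n, `|u n| <= B) -> `|l| <= B.
Proof.
move=> /cvgrPdist_lt ul uB.
have Breal : B \is Num.real by rewrite ger0_real // (le_trans _ (uB 0%N)).
rewrite real_leNgt ?normr_real //; apply/negP => lB.
have [N _ /(_ N (leqnn N))] := ul (`|l| - B) ltac:(by rewrite subr_gt0).
apply/negP; rewrite -real_leNgt ?realB ?normr_real //.
rewrite lerBlDr -[l in `|l| <= _](subrK (u N)).
by apply: le_trans (ler_normD _ _) _; rewrite lerD2l.
Qed.

Variable rho : C.
Hypotheses (rho_ge0 : 0 <= rho) (rho_lt1 : rho < 1).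

Lemma rho_re : exists2 r : R, rho = r%:C%C & 0 <= r < 1.
Proof.
have /complex_realP[r er] : rho \is Num.real by rewrite ger0_real.
by exists r => //; rewrite -lecR -ltcR -er rho_ge0 rho_lt1.
Qed.

Lemma geometric_cvg0 (M : C) : 0 <= M -> (fun n => M * rho ^+ n) @ \oo --> (0 : C).
Proof.
move=> M0; have [r -> /andP[r0 r1]] := rho_re.
have /complex_realP[m ->] : M \is Num.real by rewrite ger0_real.
have /cvgrPdist_lt h : (fun n => m * r ^+ n) @ \oo --> (0 : R).
  by apply: cvg_geometric; rewrite ger0_norm.
apply/cvgCP => e e0; have [N _ hN] := h _ e0; exists N => n /hN /=.
by rewrite !sub0r !normrN -rmorphXn -rmorphM normc_def /= expr0n /= addr0 sqrtr_sqr ltcR.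
Qed.

Lemma geometric_sum_le (M : C) m n : 0 <= M ->
  \sum_(m <= i < n) M * rho ^+ i <= M * rho ^+ m / (1 - rho).
Proof.
move=> M0; have r1 : 0 < 1 - rho by rewrite subr_gt0.
have [nm|mn] := leqP n m.
  by rewrite big_geq // divr_ge0 ?mulr_ge0 ?exprn_ge0 // ltW.
rewrite ler_pdivlMr // -mulr_sumr -mulrA ler_wpM2l //.
suff -> : (\sum_(m <= i < n) rho ^+ i) * (1 - rho) = rho ^+ m - rho ^+ n.
  by rewrite gerBl exprn_ge0.
transitivity (\sum_(m <= i < n) (- rho ^+ i.+1 - - rho ^+ i)).
  by rewrite mulr_suml; apply: eq_bigr => i _; rewrite exprS; ring.
by rewrite (telescope_sumr (fun i => - rho ^+ i)) 1?ltnW // opprK addrC.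
Qed.

(** Real and imaginary parts of the steps are dominated by their modulus, which reduces the claim to
    absolutely convergent series over [R]. *)
Lemma cvg_of_geometric_steps u (M : C) :
  (forall n, `|u n.+1 - u n| <= M * rho ^+ n) -> cvgn u.
Proof.
move=> hu; have [r er /andP[r0 r1]] := rho_re.
have M0 : 0 <= M by have := hu 0%N; rewrite expr0 mulr1; apply: le_trans.
have /complex_realP[m em] : M \is Num.real by rewrite ger0_real.
have m0 : 0 <= m by rewrite -lecR -em.
have key (f : nat -> R) : (forall n, `|f n.+1 - f n| <= m * r ^+ n) -> cvgn f.
  move=> hf.
  have : cvgn (series (fun n => f n.+1 - f n)).
    apply: normed_cvg; apply: (@series_le_cvg _ _ (geometric m r)) => //.
    - by move=> n; exact: normr_ge0.
    - by move=> n; rewrite /= mulr_ge0 ?exprn_ge0.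
    - by apply: is_cvg_geometric_series; rewrite ger0_norm.
  have -> : series (fun n => f n.+1 - f n) = (fun n => f n - f 0%N).
    by apply/funext => n; rewrite /series /= telescope_sumr.
  move=> /cvg_ex[l hl]; apply/cvg_ex; exists (l + f 0%N).
  have e : (fun n => f n - f 0%N) + cst (f 0%N) = f.
    by apply/funext => n; rewrite fctE subrK.
  have h := cvgD hl (cvg_cst (f 0%N)); rewrite e in h; exact: h.
have hC n : (`|complex.Re (u n.+1 - u n)| <= m * r ^+ n)
    /\ (`|complex.Im (u n.+1 - u n)| <= m * r ^+ n).
  have := hu n; rewrite em er -rmorphXn -rmorphM normc_def lecR => h.
  split; apply: le_trans h; rewrite -sqrtr_sqr; apply: ler_wsqrtr.
    by rewrite lerDl sqr_ge0.
  by rewrite lerDr sqr_ge0.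
have /cvg_ex[a /= /cvgrPdist_lt ha] : cvgn (fun n => complex.Re (u n)).
  by apply: key => n; have [+ _] := hC n; case: (u n.+1) (u n) => ? ? [].
have /cvg_ex[b /= /cvgrPdist_lt hb] : cvgn (fun n => complex.Im (u n)).
  by apply: key => n; have [_ +] := hC n; case: (u n.+1) (u n) => ? ? [].
suff hl : u @ \oo --> ((a +i* b)%C : C) by exact: cvgP hl.
apply/cvgCP => e e0.
have e2 : 0 < e / 2 by rewrite divr_gt0.
have [N1 _ h1] := ha _ e2; have [N2 _ h2] := hb _ e2.
exists (maxn N1 N2) => n; rewrite geq_max => /andP[/h1 /= k1 /h2 /= k2].
rewrite normc_def ltcR; move: k1 k2; case: (u n) => x y /=.
set s := a - x; set t := b - y; clearbody s t => k1 k2.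
have : `|s| + `|t| < e by lra.
apply: le_lt_trans; rewrite -[leRHS]ger0_norm ?addr_ge0 // -[leRHS]sqrtr_sqr.
apply: ler_wsqrtr; rewrite sqrrD.
rewrite !real_normK ?num_real // lerD2r lerDl.
by rewrite mulrn_wge0 ?mulr_ge0.
Qed.

Lemma cvg_of_geometric_terms m u (M : C) : 0 <= M ->
  (forall n, (m <= n)%N -> `|u n| <= M * rho ^+ n) -> summable_from m u.
Proof.
move=> M0 hu; apply: (@cvg_of_geometric_steps _ M) => n.
have [mn|nm] := leqP m n; first by rewrite big_nat_recr //= addrAC subrr add0r hu.
by rewrite !big_geq ?subrr ?normr0 ?mulr_ge0 ?exprn_ge0 // ltnW.
Qed.

Lemma geometric_series_le m u (M : C) N : 0 <= M ->
  (forall n, (m <= n)%N -> `|u n| <= M * rho ^+ n) ->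
  `|\sum_(m <= n < N) u n| <= M / (1 - rho).
Proof.
move=> M0 hu; apply: le_trans (ler_norm_sum _ _ _) _.
apply: (@le_trans _ _ (\sum_(m <= n < N) M * rho ^+ n)).
  by rewrite !big_nat ler_sum // => n /andP[mn _]; exact: hu.
apply: le_trans (geometric_sum_le _ _ M0) _.
rewrite ler_wpM2r ?invr_ge0 ?subr_ge0 ?(ltW rho_lt1) // ler_piMr //.
by rewrite exprn_ile1 // ltW.
Qed.

(** The sum is cut at a [J] beyond which the geometric majorant contributes less than [e / 2],
    uniformly in [N]; the finitely many columns before [J] tend to 0. The upper limit of summation
    moves with [N] as well. *)
Lemma tannery0 m (h : nat -> nat -> C) (M : C) : 0 <= M ->
  (forall j, (m <= j)%N -> (fun N => h N j) @ \oo --> (0 : C)) ->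
  (forall N j, (m <= j)%N -> `|h N j| <= M * rho ^+ j) ->
  (fun N => \sum_(m <= j < N) h N j) @ \oo --> (0 : C).
Proof.
move=> M0 h0 hM; apply/cvgrPdist_lt => e e0.
have r1 : 0 < 1 - rho by rewrite subr_gt0.
have e2 : 0 < e / 2 by rewrite divr_gt0.
have Mr0 : 0 <= M / (1 - rho) by rewrite divr_ge0 // ltW.
have /cvgrPdist_lt/(_ _ e2)[J0 _ /(_ J0 (leqnn _)) /= hJ0] := geometric_cvg0 Mr0.
pose J := maxn J0 m.
have hJ n : \sum_(J <= j < n) M * rho ^+ j < e / 2.
  apply: le_lt_trans (geometric_sum_le _ _ M0) _; apply: le_lt_trans hJ0.
  rewrite sub0r normrN ger0_norm; last by apply: mulr_ge0 => //; apply: exprn_ge0.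
  rewrite mulrAC ler_wpM2l //.
  by rewrite ler_wiXn2l ?(ltW rho_lt1) // leq_maxl.
have hs K : (fun N => \sum_(m <= j < K) `|h N j|) @ \oo --> (0 : C).
  elim: K => [|n IH].
    rewrite [X in X @ _](_ : _ = cst 0); first exact: cvg_cst.
    by apply/funext => N; rewrite big_geq.
  have [mn|nm] := leqP m n; last first.
    rewrite [X in X @ _](_ : _ = cst 0); first exact: cvg_cst.
    by apply/funext => N; rewrite big_geq.
  rewrite [X in X @ _](_ : _ = (fun N => \sum_(m <= j < n) `|h N j| + `|h N n|)).
    have hn := cvg_norm (h0 n mn); rewrite normr0 in hn.
    have hd := cvgD IH (hn _); rewrite addr0 in hd. exact: hd.
  by apply/funext => N; rewrite big_nat_recr.
have /cvgrPdist_lt/(_ _ e2)[N0 _ hN0] := hs J.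
exists (maxn N0 J) => // N /=; rewrite geq_max => /andP[/hN0 /= k1 JN].
rewrite sub0r normrN (big_cat_nat (n := J)) ?leq_maxr //=.
apply: le_lt_trans (ler_normD _ _) _; rewrite [e]splitr ltrD //.
  apply: le_lt_trans (ler_norm_sum _ _ _) _; apply: le_lt_trans k1.
  by rewrite sub0r normrN ger0_norm ?sumr_ge0.
apply: le_lt_trans (ler_norm_sum _ _ _) _; apply: le_lt_trans (hJ N).
rewrite !big_nat ler_sum // => j /andP[Jj _]; apply: hM.
by apply: leq_trans Jj; rewrite leq_maxr.
Qed.

Lemma tannery m (f : nat -> nat -> C) (g : nat -> C) (M : C) : 0 <= M ->
  (forall j, (m <= j)%N -> (fun N => f N j) @ \oo --> g j) ->
  (forall N j, (m <= j)%N -> `|f N j| <= M * rho ^+ j) ->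
  (fun N => \sum_(m <= j < N) f N j) @ \oo --> sum_from m g.
Proof.
move=> M0 fg fM.
have gM j : (m <= j)%N -> `|g j| <= M * rho ^+ j.
  by move=> mj; apply: norm_lim_le (fg j mj) _ => N; exact: fM.
have gs : summable_from m g := cvg_of_geometric_terms M0 gM.
have -> : (fun N => \sum_(m <= j < N) f N j) = (fun N =>
    \sum_(m <= j < N) (f N j - g j) + \sum_(m <= j < N) g j).
  by apply/funext => N; rewrite -big_split /=; apply: eq_bigr => j _; rewrite subrK.
rewrite -[sum_from m g]add0r; apply: cvgD; last exact: gs.
(* The limits [g j] inherit the majorant, so the differences are bounded by twice it. *)
apply: (@tannery0 _ _ (M + M)) => [|j mj|N j mj].
- exact: addr_ge0.
- by rewrite -(subrr (g j)); apply: cvgB; [exact: fg | exact: cvg_cst].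
- by apply: le_trans (ler_normB _ _) _; rewrite mulrDl lerD // ?fM ?gM.
Qed.

(** From [1 + x <= exp x], the product is at most the exponential of a geometric sum. *)
Lemma prod1D_bounded (c : nat -> C) (K : C) : 0 <= K ->
  (forall n, `|c n| <= K * rho ^+ n) ->
  exists2 B : C, 0 <= B & forall n, `|\prod_(0 <= i < n) (1 + c i)| <= B.
Proof.
move=> K0 hc; have [r er /andP[r0 r1]] := rho_re.
have /complex_realP[k ek] : K \is Num.real by rewrite ger0_real.
have k0 : 0 <= k by rewrite -lecR -ek.
exists (expR (k / (1 - r)))%:C%C => [|n]; first by rewrite lecR expR_ge0.
rewrite normr_prod.
apply: (@le_trans _ _ (\prod_(0 <= i < n) (1 + k * r ^+ i)%:C%C)).
  apply: ler_prod => i _; rewrite normr_ge0 /=.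
  apply: le_trans (ler_normD _ _) _; rewrite normr1 rmorphD rmorph1 lerD2l.
  by rewrite rmorphM rmorphXn /= -ek -er.
rewrite -rmorph_prod lecR.
apply: (@le_trans _ _ (\prod_(0 <= i < n) expR (k * r ^+ i))).
  apply: ler_prod => i _; rewrite expR_ge1Dx andbT.
  by rewrite addr_ge0 // mulr_ge0 // exprn_ge0.
rewrite -expR_sum ler_expR.
have := geometric_sum_le 0 n K0.
have -> : K * rho ^+ 0 / (1 - rho) = (k / (1 - r))%:C%C.
  by rewrite ek er fmorph_div rmorphB rmorph1 expr0 mulr1.
have -> : \sum_(0 <= i < n) K * rho ^+ i = (\sum_(0 <= i < n) k * r ^+ i)%:C%C.
  by rewrite rmorph_sum; apply: eq_bigr => i _; rewrite rmorphM rmorphXn /= -ek -er.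
by rewrite lecR.
Qed.

Lemma prod1D_cvg (c : nat -> C) (K : C) : 0 <= K ->
  (forall n, `|c n| <= K * rho ^+ n) -> cvgn (fun n => \prod_(0 <= i < n) (1 + c i)).
Proof.
move=> K0 hc; have [B B0 hB] := prod1D_bounded K0 hc.
apply: (@cvg_of_geometric_steps _ (B * K)) => n.
rewrite big_nat_recr //= mulrDr mulr1 addrC addKr normrM -mulrA.
by rewrite ler_pM.
Qed.

End ComplexSequences.

(** * The conjugate Bailey pair *)

Section ConjugateBaileyPair.
Variable R : realType.
Local Notation C := (Num.NumField.sort (R[i] : numFieldType)).

Lemma cvgC_near_eq (u v : nat -> C) (l : C) N :
  (forall n, (N <= n)%N -> u n = v n) -> u @ \oo --> l -> v @ \oo --> l.
Proof.
move=> uv ul; apply: cvg_trans ul; apply: near_eq_cvg.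
by exists N => // n /= Nn; rewrite uv.
Qed.

(** Allowing the lag [c] covers both [n - r] and [2 * n] as reindexings. *)
Lemma cvgC_reindex (u : nat -> C) (l : C) (phi : nat -> nat) c :
  (forall n, n <= phi n + c)%N -> u @ \oo --> l -> (fun n => u (phi n)) @ \oo --> l.
Proof.
move=> hphi /cvgCP ul; apply/cvgCP => e /ul[N hN]; exists (N + c)%N => n Nn.
by apply: hN; have := hphi n; lia.
Qed.

Variable q : C.
Hypotheses (q_gt0 : 0 < `|q|) (q_lt1 : `|q| < 1).

Lemma q_neq0 : q != 0.
Proof. by rewrite -normr_gt0. Qed.

Lemma q_tors i : q ^+ i.+1 != 1.
Proof.
apply/eqP => /(congr1 (@Num.norm _ _)); rewrite normrX normr1 => /eqP.
by rewrite lt_eqF // exprn_ilt1 // ltW.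
Qed.

(** * Infinite products and Gaussian decay *)

Lemma expq_cvg0 : (fun n => q ^+ n) @ \oo --> (0 : C).
Proof.
have /cvgrPdist_lt h := geometric_cvg0 (ltW q_gt0) q_lt1 ler01.
apply/cvgrPdist_lt => e /h[N _ hN]; exists N => // n /hN /=.
by rewrite mul1r !sub0r !normrN !normrX normr_id.
Qed.

Lemma qpoch_cvg a : qpoch a q @ \oo --> qpoch_inf a q.
Proof.
have h : cvgn (qpoch a q); last by exact: h.
apply: (prod1D_cvg (ltW q_gt0) q_lt1 (c := fun i => - (a * q ^+ i)) (normr_ge0 a)).
by move=> n; rewrite normrN normrM normrX.
Qed.

(** Since [1 / (1 - x) = 1 + x / (1 - x)], the reciprocals are again products of [1 + c_i] with
    [c_i] geometrically small, the factors [1 / (1 - a q^i)] being bounded because they converge. *)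
Lemma qpoch_inv_cvgn a : (forall i, a * q ^+ i != 1) ->
  cvgn (fun n => (qpoch a q n)^-1).
Proof.
move=> ha; have h1 i : 1 - a * q ^+ i != 0 by rewrite subr_eq0 eq_sym.
have : (fun i => (1 - a * q ^+ i)^-1) @ \oo --> ((1 - a * 0)^-1 : C).
  apply: cvgV; first by rewrite mulr0 subr0 oner_eq0.
  by apply: cvgB; [exact: cvg_cst | apply: cvgM; [exact: cvg_cst | exact: expq_cvg0]].
move=> /cvgP/cvgC_bounded[B B0 hB].
have -> : (fun n => (qpoch a q n)^-1) =
    (fun n => \prod_(0 <= i < n) (1 + a * q ^+ i / (1 - a * q ^+ i))).
  apply/funext => n; rewrite /qpoch -prodfV; apply: eq_bigr => i _.
  by field.
apply: (@prod1D_cvg _ _ (ltW q_gt0) q_lt1 _ (`|a| * B)).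
  by rewrite mulr_ge0.
move=> n; rewrite !normrM normrX -!mulrA ler_wpM2l // mulrC ler_wpM2r ?exprn_ge0 //.
exact: hB.
Qed.

(** The reciprocals converge too, and a zero limit of the products would force the constant 1 to
    tend to 0. *)
Lemma qpoch_inf_neq0 a : (forall i, a * q ^+ i != 1) -> qpoch_inf a q != 0.
Proof.
move=> ha; apply/eqP => a0; have hl := qpoch_inv_cvgn ha.
have h := cvgM (qpoch_cvg (a := a)) hl; rewrite a0 mul0r in h.
have h1 : cst 1 @ \oo --> (0 : C).
  apply: (cvgC_near_eq (N := 0)) (h _) => n _.
  by rewrite /= mulfV // qpoch_neq0.
by have := oner_neq0 C; rewrite -(cvgC_unique h1 (cvg_cst _)) eqxx.
Qed.

Lemma qpoch_inv_cvg a : (forall i, a * q ^+ i != 1) ->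
  (fun n => (qpoch a q n)^-1) @ \oo --> (qpoch_inf a q)^-1.
Proof. by move=> ha; apply: cvgV; [exact: qpoch_inf_neq0 | exact: qpoch_cvg]. Qed.

(** Dividing by [|q|^m] replaces [K] by [L = K / |q|]. Consecutive values of [v] have ratio
    [L |q|^(m+1)], eventually at most 1, so the sum of the first values bounds all of them. *)
Lemma gaussian_decay (K : C) : 0 <= K -> exists2 B : C, 0 <= B &
  forall m, K ^+ m * `|q| ^+ 'C(m.+1, 2) <= B * `|q| ^+ m.
Proof.
move=> K0; pose L := K / `|q|; have L0 : 0 <= L by rewrite divr_ge0.
pose v m := L ^+ m * `|q| ^+ 'C(m.+1, 2).
have v0 m : 0 <= v m by rewrite mulr_ge0 ?exprn_ge0.
have /cvgrPdist_lt/(_ _ ltr01)[N _ hN] := geometric_cvg0 (ltW q_gt0) q_lt1 L0.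
exists (\sum_(0 <= i < N.+1) v i) => [|m]; first by rewrite sumr_ge0.
have -> : K ^+ m * `|q| ^+ 'C(m.+1, 2) = v m * `|q| ^+ m.
  by rewrite /v mulrAC -exprMn divfK // gt_eqF.
rewrite ler_wpM2r ?exprn_ge0 //; have small k : (k <= N)%N -> v k <= \sum_(0 <= i < N.+1) v i.
  move=> kN; rewrite big_mkord (bigD1 (Ordinal (kN : (k < N.+1)%N))) //=.
  by rewrite lerDl sumr_ge0.
elim: m => [|m IH]; first exact: small.
have [mN|Nm] := leqP m.+1 N; first exact: small.
apply: le_trans IH; have -> : v m.+1 = v m * (L * `|q| ^+ m.+1).
  by rewrite /v binS bin1 exprD exprS; ring.
rewrite ler_piMr //; have /= := hN m.+1 (ltnW Nm).
by rewrite sub0r normrN ger0_norm ?mulr_ge0 ?exprn_ge0 // => /ltW.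
Qed.

Variable z : C.
Hypotheses (z_neq0 : z != 0) (z_pow : forall m : int, m != 0 -> z != q ^ m).

Local Notation Pq := (qpoch q q).
Local Notation Pz := (qpoch (z * q) q).
Local Notation Pw := (qpoch (z^-1 * q) q).
Local Notation kern := (bailey_kernel q).

Lemma Pq_factor i : q * q ^+ i != 1. Proof. by rewrite -exprS q_tors. Qed.

Lemma Pz_factor i : z * q * q ^+ i != 1.
Proof.
have /z_pow zi : - i.+1%:Z != 0 by [].
apply: contra zi => /eqP e; apply/eqP; rewrite -exprnN.
by apply: (mulIf (expf_neq0 i.+1 q_neq0)); rewrite mulVf ?expf_neq0 ?q_neq0 // exprS mulrA.
Qed.

Lemma Pw_factor i : z^-1 * q * q ^+ i != 1.
Proof.
have /z_pow zi : i.+1%:Z != 0 by [].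
apply: contra zi => /eqP e; apply/eqP; rewrite -exprnP exprS.
by rewrite -[z]mulr1 -e !mulrA mulfV // mul1r.
Qed.

Definition conj_delta n : C := Pq (2 * n) * q ^+ n / (Pz n * Pw n).

Definition conj_term r n : C := (1 - q ^+ (2 * r).+1) * conj_delta n * kern n r.

Definition conj_sum r N : C := \sum_(0 <= n < N) conj_term r n.

(** The telescoping certificate: its increments in [N] are the recurrence applied to the summands.
    For [N >= 1] the factors [1 - z q^N] and [1 - z^-1 q^N] cancel the last ones of the
    denominators; the quotient form also makes sense at [N = 0]. *)
Definition conj_boundary r N : C :=
  q ^+ r * (1 - q ^+ (2 * r).+3) * Pq (2 * N) * kern N r.+1
  * ((1 - z * q ^+ N) * (1 - z^-1 * q ^+ N)) / (Pz N * Pw N).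

(** Induction on [N]: at 0 the kernel with index [r + 1] vanishes, and the inductive step is an
    identity of rational functions. *)
Lemma conj_sum_rec r N :
  q ^+ (2 * r).+1 * conj_sum r.+2 N + (z + z^-1) * q ^+ r * conj_sum r.+1 N
    + conj_sum r N = conj_boundary r N.
Proof.
elim: N => [|N IH].
  rewrite /conj_sum !big_geq // /conj_boundary bailey_kernel_lt ?q_neq0 //.
  by rewrite !(mulr0, mul0r, addr0).
have conj_sumS s : conj_sum s N.+1 = conj_sum s N
    + (1 - q ^+ (2 * s).+1) * conj_delta N * kern N s.
  by rewrite /conj_sum big_nat_recr.
rewrite !conj_sumS.
transitivity (conj_boundary r N + (q ^+ (2 * r).+1 *
    ((1 - q ^+ (2 * r.+2).+1) * conj_delta N * kern N r.+2)
  + (z + z^-1) * q ^+ r * ((1 - q ^+ (2 * r.+1).+1) * conj_delta N * kern N r.+1)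
  + (1 - q ^+ (2 * r).+1) * conj_delta N * kern N r)).
  by rewrite -IH; ring.
rewrite /conj_boundary /conj_delta /bailey_kernel.
have -> : N%:Z - r.+2%:Z = N%:Z - r%:Z - 1 - 1 by lia.
have -> : N.+1%:Z - r.+1%:Z = N%:Z - r%:Z by lia.
have -> : N%:Z - r.+1%:Z = N%:Z - r%:Z - 1 by lia.
rewrite !ifact_pred ?q_tors //; last exact: q_tors.
rewrite [q ^ (_ - 1)]expfzDr ?q_neq0 // exprN1.
have -> : (2 * N.+1 = (2 * N).+2)%N by lia.
have -> : (N.+1 + r.+1 = (N + r).+2)%N by lia.
rewrite !addnS !qfactS !qpochS.
have /negbTE z1 : 1 - z * q * q ^+ N != 0 by rewrite subr_eq0 eq_sym Pz_factor.
have /negbTE w1 : 1 - z^-1 * q * q ^+ N != 0 by rewrite subr_eq0 eq_sym Pw_factor.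
have qn k : 1 - q ^+ k.+1 != 0 by rewrite subr_eq0 eq_sym q_tors.
have f0 k := qfact_neq0 q_tors k.
have z0 := qpoch_neq0 N Pz_factor; have w0 := qpoch_neq0 N Pw_factor.
have q0 := q_neq0.
have n1 := qn (N + r)%N; have n2 := qn (N + r).+1; have n3 := qn (N + r).+2.
have -> : 1 - z * q ^+ N.+1 = 1 - z * q * q ^+ N by rewrite exprS mulrA.
have -> : 1 - z^-1 * q ^+ N.+1 = 1 - z^-1 * q * q ^+ N by rewrite exprS mulrA.
move: n1 n2 n3.
have -> : q ^+ (2 * N).+1 = q * q ^+ N * q ^+ N by rewrite mul2n -addnn exprS exprD mulrA.
have -> : q ^+ (2 * N).+2 = q * q * q ^+ N * q ^+ N.
  by rewrite mul2n -addnn !exprS exprD !mulrA.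
have -> : q ^+ (2 * r).+1 = q * q ^+ r * q ^+ r by rewrite mul2n -addnn exprS exprD mulrA.
have -> : q ^+ (2 * r).+3 = q ^+ 3 * q ^+ r * q ^+ r.
  by rewrite mul2n -addnn !exprS exprD !mulrA mulr1.
have -> : q ^+ (2 * r.+1).+1 = q ^+ 3 * q ^+ r * q ^+ r.
  by rewrite -!exprD; congr (_ ^+ _); lia.
have -> : q ^+ (2 * r.+2).+1 = q ^+ 5 * q ^+ r * q ^+ r.
  by rewrite -!exprD; congr (_ ^+ _); lia.
have -> : q ^+ (N + r).+1 = q * q ^+ N * q ^+ r by rewrite exprS exprD mulrA.
have -> : q ^+ (N + r).+2 = q ^+ 2 * q ^+ N * q ^+ r by rewrite -!exprD.
have -> : q ^+ (N + r).+3 = q ^+ 3 * q ^+ N * q ^+ r by rewrite -!exprD.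
move: z1 w1.
(* Only [q^(N-r)], [q^r] and [1 / (q)_(N-r)] remain, and they become free variables; the case
   [N < r], where the last one is 0, needs no separate treatment. *)
have -> : q ^+ N = q ^ (N%:Z - r%:Z) * q ^+ r.
  by rewrite !exprnP -expfzDr ?q_neq0 // subrK.
move: (q ^ (N%:Z - r%:Z)) (q ^+ r) (inv_qfact q (N%:Z - r%:Z)) => Y X a z1 w1 n1 n2 n3.
(* This is the factor [1 - z^-1 q^(N+1)] multiplied by [z], the form in which it appears once [z^-1]
   is cleared. *)
have z2 : z - q * (Y * X) != 0.
  apply: contraFN w1; rewrite subr_eq0 => /eqP e.
  by rewrite -[z^-1 * _ * _]mulrA -e mulVf // subrr.
field.
  by rewrite z_neq0 z2 w0 z1 z0 n1 n2 n3 f0 q0.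
all: try exact: q_neq0.
all: exact: q_tors.
Qed.

Lemma ifact_bounded : exists2 B : C, 0 <= B & forall m, `|inv_qfact q m| <= B.
Proof.
have [B B0 hB] := cvgC_bounded (qpoch_inv_cvgn Pq_factor).
by exists B => // -[n|n] /=; rewrite ?normr0.
Qed.

Lemma kern_bounded : exists2 B : C, 0 <= B & forall n r, `|kern n r| <= B.
Proof.
have [B B0 hB] := ifact_bounded; exists (B * B) => [|n r]; first exact: mulr_ge0.
by rewrite normrM ler_pM //; exact: (hB (n + r).+1).
Qed.

Lemma conj_delta_bounded :
  exists2 B : C, 0 <= B & forall n, `|conj_delta n| <= B * `|q| ^+ n.
Proof.
have [B1 B10 h1] := cvgC_bounded (cvgP _ (qpoch_cvg (a := q))).
have [B2 B20 h2] := cvgC_bounded (qpoch_inv_cvgn Pz_factor).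
have [B3 B30 h3] := cvgC_bounded (qpoch_inv_cvgn Pw_factor).
exists (B1 * (B2 * B3)) => [|n]; first by rewrite !mulr_ge0.
rewrite /conj_delta invfM !normrM normrX mulrAC.
rewrite ler_wpM2r ?exprn_ge0 //; apply: ler_pM; rewrite ?mulr_ge0 //.
  exact: h1.
by apply: ler_pM => //; [exact: h2 | exact: h3].
Qed.

Lemma norm_1Bexp m : `|1 - q ^+ m| <= 2.
Proof.
apply: le_trans (ler_normB _ _) _; rewrite normr1 normrX [leRHS](_ : _ = 1 + 1) //.
by rewrite lerD2l exprn_ile1 // ltW.
Qed.

(** The bound is uniform in [r], as required both for the uniqueness of bounded solutions of the
    recurrence and for Tannery's theorem. *)
Lemma conj_term_bounded :
  exists2 B : C, 0 <= B & forall r n, `|conj_term r n| <= B * `|q| ^+ n.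
Proof.
have [B1 B10 h1] := conj_delta_bounded; have [B2 B20 h2] := kern_bounded.
exists (2 * B1 * B2) => [|r n]; first by rewrite !mulr_ge0.
rewrite /conj_term [`|_ * kern _ _|]normrM [`|_ * conj_delta _|]normrM.
have -> : 2 * B1 * B2 * `|q| ^+ n = 2 * (B1 * `|q| ^+ n) * B2 by ring.
by rewrite ler_pM ?mulr_ge0 ?h2 // ler_pM ?h1 ?norm_1Bexp.
Qed.

Definition conj_lim r : C := sum_from 0 (conj_term r).

Lemma conj_sum_cvg r : conj_sum r @ \oo --> conj_lim r.
Proof.
have [B B0 hB] := conj_term_bounded.
exact: (cvg_of_geometric_terms (ltW q_gt0) q_lt1 B0 (fun n _ => hB r n)).
Qed.

Lemma conj_sum_bounded : exists2 B : C, 0 <= B & forall r N, `|conj_sum r N| <= B.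
Proof.
have [B B0 hB] := conj_term_bounded; exists (B / (1 - `|q|)) => [|r N].
  by rewrite divr_ge0 // subr_ge0 ltW.
exact: (geometric_series_le (ltW q_gt0) q_lt1 _ B0 (fun n _ => hB r n)).
Qed.

Lemma kern_cvg r : (fun n => kern n r) @ \oo --> ((qpoch_inf q q)^-1 / qpoch_inf q q : C).
Proof.
apply: (cvgC_near_eq (N := r) (u := fun n => (Pq (n - r))^-1 * (Pq (n + r).+1)^-1)).
  by move=> n rn; rewrite /bailey_kernel ifact_nat ?q_neq0 //; exact: q_tors.
have h := qpoch_inv_cvg Pq_factor.
apply: cvgM.
  by apply: (cvgC_reindex (c := r)) h => n; lia.
by apply: (cvgC_reindex (c := 0%N)) h => n; lia.
Qed.

Definition theta_const : C := qpoch_inf (z * q) q * qpoch_inf (z^-1 * q) q * qpoch_inf q q.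

Lemma theta_const_neq0 : theta_const != 0.
Proof.
by rewrite !mulf_neq0 ?qpoch_inf_neq0 //; [exact: Pz_factor|exact: Pw_factor|exact: Pq_factor].
Qed.

Lemma conj_boundary_cvg r : conj_boundary r @ \oo -->
  (q ^+ r * (1 - q ^+ (2 * r).+3) / theta_const : C).
Proof.
have hq : (fun n => 1 - z * q ^+ n) @ \oo --> (1 - z * 0 : C).
  by apply: cvgB; [exact: cvg_cst | apply: cvgM; [exact: cvg_cst | exact: expq_cvg0]].
have hq' : (fun n => 1 - z^-1 * q ^+ n) @ \oo --> (1 - z^-1 * 0 : C).
  by apply: cvgB; [exact: cvg_cst | apply: cvgM; [exact: cvg_cst | exact: expq_cvg0]].
have hP : (fun n => Pq (2 * n)) @ \oo --> (qpoch_inf q q : C).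
  by apply: (cvgC_reindex (c := 0%N)) (qpoch_cvg (a := q)) => n; lia.
have h := cvgCM (cvgCM (cvgCM (cvgCMl (a := q ^+ r * (1 - q ^+ (2 * r).+3)) hP)
  (kern_cvg r.+1)) (cvgCM hq hq')) (cvgCM (qpoch_inv_cvg Pz_factor) (qpoch_inv_cvg Pw_factor)).
have q1 := qpoch_inf_neq0 Pq_factor.
have z1 := qpoch_inf_neq0 Pz_factor; have w1 := qpoch_inf_neq0 Pw_factor.
have -> : q ^+ r * (1 - q ^+ (2 * r).+3) / theta_const =
  q ^+ r * (1 - q ^+ (2 * r).+3) * qpoch_inf q q * ((qpoch_inf q q)^-1 / qpoch_inf q q)
  * ((1 - z * 0) * (1 - z^-1 * 0)) * ((qpoch_inf (z * q) q)^-1 / qpoch_inf (z^-1 * q) q).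
  rewrite /theta_const !mulr0 !subr0; move: q1 z1 w1; clear.
  move: (qpoch_inf q q) (qpoch_inf (z * q) q) (qpoch_inf (z^-1 * q) q) => a b c.
  by move=> a0 b0 c0; field; rewrite a0 b0 c0.
apply: (cvgC_near_eq (N := 0%N)) h => n _.
by rewrite /conj_boundary invfM.
Qed.

Lemma conj_lim_rec r :
  q ^+ (2 * r).+1 * conj_lim r.+2 + (z + z^-1) * q ^+ r * conj_lim r.+1 + conj_lim r
  = q ^+ r * (1 - q ^+ (2 * r).+3) / theta_const.
Proof.
have h := cvgCD (cvgCD (cvgCMl (a := q ^+ (2 * r).+1) (conj_sum_cvg (r := r.+2)))
  (cvgCMl (a := (z + z^-1) * q ^+ r) (conj_sum_cvg (r := r.+1)))) (conj_sum_cvg (r := r)).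
apply: cvgC_unique h _.
apply: (cvgC_near_eq (N := 0%N)) (conj_boundary_cvg (r := r)) => n _.
by rewrite -conj_sum_rec.
Qed.

End ConjugateBaileyPair.

(** * The partial theta series *)

Section PartialTheta.
Variable R : realType.
Local Notation C := (Num.NumField.sort (R[i] : numFieldType)).

(** Once [K rho^r <= 1/4], each use of the recurrence halves the bound on all far terms, which are
    therefore 0. The recurrence then carries the vanishing down to every index. *)
Lemma bounded_recurrence_eq0 (rho : C) (D : nat -> C) (B K : C) :
  0 <= rho -> rho < 1 -> 0 <= B -> 0 <= K -> (forall r, `|D r| <= B) ->
  (forall r, `|D r| <= K * rho ^+ r * (`|D r.+1| + `|D r.+2|)) -> forall r, D r = 0.
Proof.
move=> rho0 rho1 B0 K0 DB DK.
have half0 : 0 <= 2^-1 :> C by rewrite invr_ge0.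
have half1 : 2^-1 < 1 :> C by rewrite invf_lt1 // ltr1n.
have K4 : 0 <= K * 4 by rewrite mulr_ge0.
have /cvgrPdist_lt/(_ _ ltr01)[N _ hN] := geometric_cvg0 rho0 rho1 K4.
have small n : (N <= n)%N -> K * rho ^+ n * 4 <= 1.
  have -> : K * rho ^+ n * 4 = K * 4 * rho ^+ n by ring.
  move=> /hN /=; rewrite sub0r normrN ger0_norm; first exact: ltW.
  by apply: mulr_ge0 => //; exact: exprn_ge0.
have decay s n : (N <= n)%N -> `|D n| <= B * 2^-1 ^+ s.
  elim: s n => [|s IH] n Nn; first by rewrite expr0 mulr1.
  apply: le_trans (DK n) _.
  apply: (@le_trans _ _ (K * rho ^+ n * (B * 2^-1 ^+ s + B * 2^-1 ^+ s))).
    by rewrite ler_wpM2l ?mulr_ge0 ?exprn_ge0 // lerD // IH // ltnW // ltnW.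
  have -> : K * rho ^+ n * (B * 2^-1 ^+ s + B * 2^-1 ^+ s) =
      (K * rho ^+ n * 4) * (B * 2^-1 ^+ s.+1).
    by rewrite exprS; field.
  by rewrite ler_piMl ?small // mulr_ge0 ?exprn_ge0.
have tail n : (N <= n)%N -> D n = 0.
  move=> Nn; apply/eqP; rewrite -normr_le0 real_leNgt ?real0 ?normr_real //.
  apply/negP => Dn0.
  have /cvgrPdist_lt/(_ _ Dn0)[s _ /(_ s (leqnn _)) /=] := geometric_cvg0 half0 half1 B0.
  rewrite sub0r normrN ger0_norm ?mulr_ge0 ?exprn_ge0 //.
  by apply/negP; rewrite -real_leNgt ?decay ?normr_real // ger0_real ?mulr_ge0 ?exprn_ge0.
suff all k n : (N <= n + k)%N -> D n = 0 by move=> r; apply: (all N); lia.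
elim: k n => [|k IH] n nk; first by apply: tail; lia.
apply/eqP; rewrite -normr_le0; apply: le_trans (DK n) _.
by rewrite (IH n.+1) ?(IH n.+2) ?normr0 ?addr0 ?mulr0 //; clear -nk; lia.
Qed.

Variables q z : C.
Hypotheses (q_gt0 : 0 < `|q|) (q_lt1 : `|q| < 1).
Hypotheses (z_neq0 : z != 0) (z_pow : forall m : int, m != 0 -> z != q ^ m).

Definition theta_term r m : C :=
  (-1) ^+ m * (z ^+ m + z^-1 ^+ m) * q ^+ (r + m * r + 'C(m.+1, 2)).

(** The constant term stands apart because [theta_term r 0] equals [2 q^r]. *)
Definition theta_sum r N : C := q ^+ r + \sum_(1 <= m < N) theta_term r m.

Definition theta_lim r : C := q ^+ r + sum_from 1 (theta_term r).

(** All three terms carry the same power of [q]. With [a_m = z^m + z^-m], what remains is [a_(m+1) -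
    (z + 1/z) a_(m+2) + a_(m+3) = 0]. *)
Lemma theta_term_rec r m :
  q ^+ (2 * r).+1 * theta_term r.+2 m.+1
    + (z + z^-1) * q ^+ r * theta_term r.+1 m.+2 + theta_term r m.+3 = 0.
Proof.
rewrite /theta_term; set c := 'C(m.+2, 2).
have e1 : (m.+2 + c = 'C(m.+3, 2))%N by rewrite [in RHS]binS bin1 addnC.
have e2 : (m.+3 + (m.+2 + c) = 'C(m.+4, 2))%N.
  by rewrite [in RHS]binS bin1 addnC -e1.
rewrite -e1 -e2.
set x := q ^+ (r.+2 + _ + _); set y := q ^+ (r.+1 + _ + _).
have ex : q ^+ (2 * r).+1 * x = q ^+ (r + m.+3 * r + (m.+3 + (m.+2 + c))).
  by rewrite -exprD; congr (_ ^+ _); lia.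
have ey : q ^+ r * y = q ^+ (r + m.+3 * r + (m.+3 + (m.+2 + c))).
  by rewrite -exprD; congr (_ ^+ _); lia.
move: ex ey; set w := q ^+ (r + _ + (_ + _)) => ex ey.
transitivity ((-1) ^+ m.+1 * (z ^+ m.+1 + z^-1 ^+ m.+1) * (q ^+ (2 * r).+1 * x)
  + (z + z^-1) * ((-1) ^+ m.+2 * (z ^+ m.+2 + z^-1 ^+ m.+2)) * (q ^+ r * y)
  + (-1) ^+ m.+3 * (z ^+ m.+3 + z^-1 ^+ m.+3) * w); first by ring.
rewrite ex ey; clearbody w; rewrite !exprS.
move: (z ^+ m) (z^-1 ^+ m) ((-1) ^+ m) => s t u; field.
exact: z_neq0.
Qed.

(** The staggered cutoffs match the indices of [theta_term_rec], so the recurrence is exact at every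
    finite stage; its right-hand side comes from the initial terms alone. *)
Lemma theta_sum_rec r N :
  q ^+ (2 * r).+1 * theta_sum r.+2 N.+1 + (z + z^-1) * q ^+ r * theta_sum r.+1 N.+2
    + theta_sum r N.+3 = q ^+ r * (1 - q ^+ (2 * r).+3).
Proof.
have S s n : theta_sum s n.+2 = theta_sum s n.+1 + theta_term s n.+1.
  by rewrite /theta_sum big_nat_recr //= addrA.
have S1 s : theta_sum s 1 = q ^+ s by rewrite /theta_sum big_geq // addr0.
elim: N => [|N IH].
  rewrite !S !S1 /theta_term !mul1n [in 'C(3, 2)]/binomial /=.
  have -> : q ^+ (r.+1 + r.+1 + 1) = q ^+ 3 * q ^+ r * q ^+ r.
    by rewrite -!exprD; congr (_ ^+ _); lia.
  have -> : q ^+ (r + r + 1) = q * q ^+ r * q ^+ r.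
    by rewrite -[X in X * _ * _]expr1 -!exprD; congr (_ ^+ _); lia.
  have -> : q ^+ (r + 2 * r + 3) = q ^+ 3 * q ^+ r * q ^+ r * q ^+ r.
    by rewrite -!exprD; congr (_ ^+ _); lia.
  rewrite mul2n -addnn !exprS exprD.
  by move: (q ^+ r) => X; field; exact: z_neq0.
rewrite (S _ N) (S _ N.+1) (S _ N.+2) -IH.
transitivity (q ^+ (2 * r).+1 * theta_sum r.+2 N.+1
  + (z + z^-1) * q ^+ r * theta_sum r.+1 N.+2 + theta_sum r N.+3
  + (q ^+ (2 * r).+1 * theta_term r.+2 N.+1
    + (z + z^-1) * q ^+ r * theta_term r.+1 N.+2 + theta_term r N.+3)); first by ring.
by rewrite theta_term_rec addr0.
Qed.

Lemma theta_term_bounded :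
  exists2 B : C, 0 <= B & forall r m, `|theta_term r m| <= B * `|q| ^+ m.
Proof.
have [B1 B10 h1] := gaussian_decay q_gt0 q_lt1 (normr_ge0 z).
have [B2 B20 h2] := gaussian_decay q_gt0 q_lt1 (normr_ge0 z^-1).
exists (B1 + B2) => [|r m]; first exact: addr_ge0.
rewrite /theta_term !normrM normrX normrN1 expr1n mul1r normrX.
apply: (@le_trans _ _ ((`|z| ^+ m + `|z^-1| ^+ m) * `|q| ^+ 'C(m.+1, 2))).
  rewrite ler_pM ?exprn_ge0 //; first by rewrite -!normrX ler_normD.
  by rewrite ler_wiXn2l ?(ltW q_lt1) // leq_addl.
by rewrite !mulrDl; apply: lerD; [exact: h1 | exact: h2].
Qed.

Lemma theta_sum_cvg r : theta_sum r @ \oo --> theta_lim r.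
Proof.
have [B B0 hB] := theta_term_bounded.
have h := cvg_of_geometric_terms (ltW q_gt0) q_lt1 B0 (fun n (_ : (1 <= n)%N) => hB r n).
exact: (cvgCD (cvg_cst (q ^+ r)) h).
Qed.

Lemma theta_sum_bounded : exists2 B : C, 0 <= B & forall r N, `|theta_sum r N| <= B.
Proof.
have [B B0 hB] := theta_term_bounded; exists (1 + B / (1 - `|q|)) => [|r N].
  by rewrite addr_ge0 // divr_ge0 // subr_ge0 ltW.
apply: le_trans (ler_normD _ _) _; apply: lerD.
  by rewrite normrX exprn_ile1 // ltW.
exact: (geometric_series_le (ltW q_gt0) q_lt1 _ B0 (fun n _ => hB r n)).
Qed.

Lemma theta_lim_rec r :
  q ^+ (2 * r).+1 * theta_lim r.+2 + (z + z^-1) * q ^+ r * theta_lim r.+1 + theta_lim r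
  = q ^+ r * (1 - q ^+ (2 * r).+3).
Proof.
have sh k s : (fun N => theta_sum s (N + k)%N) @ \oo --> theta_lim s.
  by apply: (cvgC_reindex (c := 0%N)) (theta_sum_cvg (r := s)) => n; lia.
have h := cvgCD (cvgCD (cvgCMl (a := q ^+ (2 * r).+1) (sh 1%N r.+2))
  (cvgCMl (a := (z + z^-1) * q ^+ r) (sh 2%N r.+1))) (sh 3%N r).
apply: cvgC_unique h _; set c := (X in _ --> X).
apply: (cvgC_near_eq (N := 0%N) (u := cst c)) (cvg_cst _) => n _.
by rewrite addn1 addn2 addn3 theta_sum_rec.
Qed.

Lemma conj_lim_theta r : theta_const q z * conj_lim q z r = theta_lim r.
Proof.
have [B1 B10 h1] := conj_sum_bounded q_gt0 q_lt1 z_neq0 z_pow.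
have [B2 B20 h2] := theta_sum_bounded.
set W := theta_const q z; pose D s := W * conj_lim q z s - theta_lim s.
have W0 : W != 0 by exact: theta_const_neq0.
suff: forall s, D s = 0 by move=> /(_ r)/subr0_eq.
have DB s : `|D s| <= `|W| * B1 + B2.
  apply: le_trans (ler_normB _ _) _; apply: lerD.
    rewrite [`|W * _|]normrM; apply: ler_wpM2l; first exact: normr_ge0.
    exact: (norm_lim_le (conj_sum_cvg q_gt0 q_lt1 z_neq0 z_pow (r := s)) (h1 s)).
  exact: (norm_lim_le (theta_sum_cvg (r := s)) (h2 s)).
have Drec s : D s = - ((z + z^-1) * q ^+ s * D s.+1) - q ^+ (2 * s).+1 * D s.+2.
  have e1 := conj_lim_rec q_gt0 q_lt1 z_neq0 z_pow s; have e2 := theta_lim_rec s.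
  rewrite -e2 -/W in e1.
  have e3 := congr1 (fun x => W * x) e1.
  rewrite [W * (_ / _)]mulrCA mulfV // mulr1 in e3.
  move: e3; rewrite /D; clear; clearbody W.
  move: (conj_lim q z s) (conj_lim q z s.+1) (conj_lim q z s.+2).
  move: (theta_lim s) (theta_lim s.+1) (theta_lim s.+2) => t0 t1 t2 c0 c1 c2 e3.
  apply/eqP; rewrite -subr_eq0; apply/eqP.
  transitivity (W * (q ^+ (2 * s).+1 * c2 + (z + z^-1) * q ^+ s * c1 + c0)
    - (q ^+ (2 * s).+1 * t2 + (z + z^-1) * q ^+ s * t1 + t0)); first by ring.
  by rewrite e3 subrr.
(* The constant dominates both coefficients, since [|q|^(2s+1) <= |q|^s]. *)
apply: (@bounded_recurrence_eq0 `|q| D (`|W| * B1 + B2) (`|z + z^-1| + 1)) => //.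
- by rewrite addr_ge0 ?mulr_ge0.
move=> s; rewrite Drec; apply: le_trans (ler_normB _ _) _.
rewrite normrN !normrM !normrX mulrDr; apply: lerD.
  by rewrite !ler_wpM2r ?exprn_ge0 // lerDl.
rewrite ler_wpM2r //; apply: (@le_trans _ _ (1 * `|q| ^+ s)).
  by rewrite mul1r ler_wiXn2l ?(ltW q_lt1) //; lia.
by rewrite ler_wpM2r ?exprn_ge0 // lerDr.
Qed.

End PartialTheta.

(** * Regrouping the double series *)

Section HeckeSums.
Variable R : realType.
Local Notation C := (Num.NumField.sort (R[i] : numFieldType)).
Variables q z : C.
Hypotheses (q_gt0 : 0 < `|q|) (q_lt1 : `|q| < 1).
Hypotheses (z_neq0 : z != 0) (z_pow : forall m : int, m != 0 -> z != q ^ m).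
Variable m : nat.

Local Notation B0 := (bailey_coef0 q m.+1).
Local Notation B1 := (bailey_coef1 q m.+1).
Local Notation W := (theta_const q z).

Lemma norm_bailey_coef0 j : `|B0 j| <= `|q| ^+ j.
Proof. by rewrite normrX ler_wiXn2l ?(ltW q_lt1) //; nia. Qed.

Lemma norm_bailey_coef1 j : (1 <= j)%N -> `|B1 j| <= `|q| ^+ j.
Proof. by move=> j1; rewrite normrX ler_wiXn2l ?(ltW q_lt1) //; nia. Qed.

Lemma bailey_tannery s (b : nat -> C) (f : nat -> nat -> C)
    (g : nat -> C) (B : C) : 0 <= B ->
  (forall j, (s <= j)%N -> `|b j| <= `|q| ^+ j) ->
  (forall j, f j @ \oo --> g j) -> (forall j N, `|f j N| <= B) ->
  (fun N => \sum_(s <= j < N) b j * f j N) @ \oo --> sum_from s (fun j => b j * g j).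
Proof.
move=> B0 hb fg fB.
apply: (tannery (ltW q_gt0) q_lt1 (f := fun N j => b j * f j N) B0) => [j sj|N j sj].
  exact: (cvgCMl (a := b j) (fg j)).
rewrite normrM mulrC; apply: ler_pM; rewrite ?normr_ge0 //; first exact: fB.
exact: hb.
Qed.

(** Expanding every multiple sum with the cutoff [J = N - 1] puts [n] and [j] in the same finite
    square, so only finite sums are exchanged. *)
Lemma lhs_partial_sum N :
  \sum_(0 <= n < N) lhs_term m.+2 q z n =
  \sum_(0 <= j < N) B0 j * conj_sum q z (3 * j) N
  - \sum_(1 <= j < N) B1 j * conj_sum q z (3 * j - 1) N.
Proof.
case: N => [|J]; first by rewrite !big_geq // subrr.
have q0 := q_neq0 q_gt0; have qt := q_tors q_lt1.
transitivity (\sum_(0 <= n < J.+1) (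
    \sum_(0 <= j < J.+1) B0 j * conj_term q z (3 * j) n
    - \sum_(1 <= j < J.+1) B1 j * conj_term q z (3 * j - 1) n)).
  apply: eq_big_nat => n /andP[_ nJ].
  rewrite /lhs_term (multisumE q0 qt _ (J := J)) // mulrBr !mulr_sumr.
  by congr (_ - _); apply: eq_bigr => j _; rewrite /conj_term /conj_delta; ring.
by rewrite sumrB; congr (_ - _); rewrite exchange_big; apply: eq_bigr => j _;
  rewrite -mulr_sumr.
Qed.

Lemma lhs_cvg : (fun N => W * \sum_(0 <= n < N) lhs_term m.+2 q z n) @ \oo -->
  sum_from 0 (fun j => B0 j * theta_lim q z (3 * j))
  - sum_from 1 (fun j => B1 j * theta_lim q z (3 * j - 1)).
Proof.
have [B B_ge0 hB] := conj_sum_bounded q_gt0 q_lt1 z_neq0 z_pow.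
have WB : 0 <= `|W| * B by rewrite mulr_ge0.
have lim r : (fun N => W * conj_sum q z r N) @ \oo --> theta_lim q z r.
  rewrite -(conj_lim_theta q_gt0 q_lt1 z_neq0 z_pow).
  exact: (cvgCMl (a := W) (conj_sum_cvg q_gt0 q_lt1 z_neq0 z_pow (r := r))).
have bnd r N : `|W * conj_sum q z r N| <= `|W| * B.
  by rewrite normrM; apply: ler_wpM2l; [exact: normr_ge0 | exact: hB].
have h0 := bailey_tannery (s := 0%N) (f := fun j N => W * conj_sum q z (3 * j) N) WB
  (fun j _ => norm_bailey_coef0 j) (fun j => lim (3 * j)%N) (fun j => bnd (3 * j)%N).
have h1 := bailey_tannery (s := 1%N) (f := fun j N => W * conj_sum q z (3 * j - 1) N) WB
  norm_bailey_coef1 (fun j => lim (3 * j - 1)%N) (fun j => bnd (3 * j - 1)%N).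
have h := cvgCD h0 (cvgCN h1).
apply: (cvgC_near_eq (N := 0%N)) h => N _.
rewrite lhs_partial_sum mulrBr !mulr_sumr.
by congr (_ - _); apply: eq_bigr => j _; ring.
Qed.

Lemma sum_nat_gt (a N : nat) (F : nat -> C) :
  \sum_(0 <= n < N | (a < n)%N) F n = \sum_(1 <= i < N - a) F (i + a)%N.
Proof.
rewrite -(big_addn 1 N a xpredT F) add1n [RHS](@big_nat_widenl _ _ _ a.+1 0) //.
Qed.

Lemma double_bin2 i : (2 * 'C(i.+1, 2) = i.+1 * i)%N.
Proof. by elim: i => // i IH; rewrite binS mulnDr IH bin1; lia. Qed.

(** Here [n + j = i + 4j] has the parity of [i], and [n^2 - 3j^2 + n - j] is twice
    [3j^2 + j + 3ij + i(i+1)/2]. *)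
Lemma rhs_term1_shift j i (n := (i + 3 * j)%N) :
  (-1) ^+ (n + j) * (z ^ (n%:Z - 3%:Z * j%:Z) + z ^ (3%:Z * j%:Z - n%:Z))
    * q ^+ ((n ^ 2 - 3 * j ^ 2 + (n - j))./2 + 3 * (m.+2 - 1) * j * (3 * j + 1))%N
  = B0 j * theta_term q z (3 * j) i.
Proof.
have -> : n%:Z - 3%:Z * j%:Z = i by lia.
have -> : 3%:Z * j%:Z - n%:Z = - i%:Z by lia.
have -> : (-1) ^+ (n + j) = (-1) ^+ i :> C.
  rewrite (_ : n + j = i + (2 * j) * 2)%N; last by lia.
  by rewrite exprD exprM sqrr_sign mulr1.
have -> : (n ^ 2 - 3 * j ^ 2 + (n - j) = (3 * j ^ 2 + j + i * (3 * j) + 'C(i.+1, 2)).*2)%N.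
  by have := double_bin2 i; rewrite -!mul2n /n; nia.
rewrite doubleK /theta_term /bailey_coef0 -exprnP -exprnN -exprVn.
rewrite [RHS]mulrCA -exprD; congr (_ * q ^+ _).
have : (2 * j <= 3 * j ^ 2)%N by nia.
by move: ('C(_, _)) => c; nia.
Qed.

(** Now [n + j = i + 4j - 1] has the opposite parity to [i]; this is the minus sign in front of the
    [r = 3j - 1] family. *)
Lemma rhs_term2_shift j i (n := (i + (3 * j - 1))%N) : (1 <= j)%N ->
  (-1) ^+ (n + j) * (z ^ (n%:Z - 3%:Z * j%:Z + 1) + z ^ (3%:Z * j%:Z - n%:Z - 1))
    * q ^+ ((n ^ 2 - 3 * j ^ 2 + (n + j))./2 + 3 * (m.+2 - 1) * j * (3 * j - 1))%N
  = - (B1 j * theta_term q z (3 * j - 1) i).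
Proof.
move=> j1; have -> : n%:Z - 3%:Z * j%:Z + 1 = i by lia.
have -> : 3%:Z * j%:Z - n%:Z - 1 = - i%:Z by lia.
have -> : (-1) ^+ (n + j) = - (-1) ^+ i :> C.
  rewrite (_ : n + j = (i + (2 * j - 1) * 2).+1)%N; last by lia.
  by rewrite exprS exprD exprM sqrr_sign mulr1 mulN1r.
have -> : (n ^ 2 - 3 * j ^ 2 + (n + j) =
    (3 * j ^ 2 - j + i * (3 * j - 1) + 'C(i.+1, 2)).*2)%N.
  by have := double_bin2 i; rewrite -!mul2n /n; nia.
rewrite doubleK /theta_term /bailey_coef1 -exprnP -exprnN -exprVn.
rewrite !mulNr [in RHS]mulrCA -exprD; congr (- (_ * q ^+ _)).
have : (4 * j <= 3 * j ^ 2 + 1)%N by nia.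
by move: ('C(_, _)) => c; nia.
Qed.

(** The range of [j] is enlarged to a square, where [3j < n] selects the same terms, and the sums
    are exchanged. As the inequality is strict, [i = n - 3j] starts at 1: the leading term [q^(3j)]
    of the theta series is absent and must be subtracted. *)
Lemma rhs_term1_partial_sum N :
  \sum_(0 <= n < N) rhs_term1 m.+2 q z n =
  \sum_(0 <= j < N) B0 j * (theta_sum q z (3 * j) (N - 3 * j) - q ^+ (3 * j)).
Proof.
pose F n j : C :=
  (-1) ^+ (n + j) * (z ^ (n%:Z - 3%:Z * j%:Z) + z ^ (3%:Z * j%:Z - n%:Z))
  * q ^+ ((n ^ 2 - 3 * j ^ 2 + (n - j))./2 + 3 * (m.+2 - 1) * j * (3 * j + 1))%N.
transitivity (\sum_(0 <= n < N) \sum_(0 <= j < N | (3 * j < n)%N) F n j).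
  apply: eq_big_nat => n /andP[_ nN].
  rewrite [RHS](big_cat_nat (n := n)) ?(ltnW nN) //= [X in _ + X]big_nat_cond.
  by rewrite [X in _ + X]big1 ?addr0 // => j; lia.
rewrite (exchange_big_dep predT) //=; apply: eq_bigr => j _.
rewrite sum_nat_gt /theta_sum addrAC subrr add0r mulr_sumr.
by apply: eq_bigr => i _; exact: rhs_term1_shift.
Qed.

Lemma rhs_term2_partial_sum N :
  \sum_(0 <= n < N) rhs_term2 m.+2 q z n =
  - \sum_(1 <= j < N) B1 j
      * (theta_sum q z (3 * j - 1) (N - (3 * j - 1)) - q ^+ (3 * j - 1)).
Proof.
pose F n j : C :=
  (-1) ^+ (n + j) * (z ^ (n%:Z - 3%:Z * j%:Z + 1) + z ^ (3%:Z * j%:Z - n%:Z - 1))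
  * q ^+ ((n ^ 2 - 3 * j ^ 2 + (n + j))./2 + 3 * (m.+2 - 1) * j * (3 * j - 1))%N.
transitivity (\sum_(0 <= n < N) \sum_(1 <= j < N | (3 * j < n + 1)%N) F n j).
  apply: eq_big_nat => n /andP[_ nN].
  rewrite [RHS](big_cat_nat (n := n.+1)) //= [X in _ + X]big_nat_cond.
  by rewrite [X in _ + X]big1 ?addr0 // => j; lia.
rewrite (exchange_big_dep predT) //= -sumrN; apply: eq_big_nat => j /andP[j1 _].
rewrite (eq_bigl (fun n => (3 * j - 1 < n)%N)); last by move=> n; lia.
rewrite sum_nat_gt /theta_sum addrAC subrr add0r mulr_sumr -sumrN.
by apply: eq_bigr => i _; exact: rhs_term2_shift.
Qed.

Lemma theta_tail_cvg r :
  (fun N => theta_sum q z r (N - r) - q ^+ r) @ \oo --> theta_lim q z r - q ^+ r.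
Proof.
have h : (fun N => theta_sum q z r (N - r)) @ \oo --> theta_lim q z r.
  apply: (cvgC_reindex (u := theta_sum q z r) (phi := fun N => (N - r)%N) (c := r)).
    by move=> n; lia.
  exact: theta_sum_cvg.
exact: (cvgCD h (cvg_cst (- q ^+ r))).
Qed.

Lemma theta_tail_bounded :
  exists2 B : C, 0 <= B & forall r N, `|theta_sum q z r N - q ^+ r| <= B.
Proof.
have [B B_ge0 hB] := theta_sum_bounded z q_gt0 q_lt1.
exists (B + 1) => [|r N]; first exact: addr_ge0.
apply: le_trans (ler_normB _ _) _; apply: lerD; first exact: hB.
by rewrite normrX exprn_ile1 // ltW.
Qed.

Lemma rhs_term1_cvg : (fun N => \sum_(0 <= n < N) rhs_term1 m.+2 q z n) @ \oo -->
  sum_from 0 (fun j => B0 j * (theta_lim q z (3 * j) - q ^+ (3 * j))).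
Proof.
have [B B_ge0 hB] := theta_tail_bounded.
have h := bailey_tannery (s := 0%N)
  (f := fun j N => theta_sum q z (3 * j) (N - 3 * j) - q ^+ (3 * j)) B_ge0
  (fun j _ => norm_bailey_coef0 j) (fun j => theta_tail_cvg (r := (3 * j)%N)) (fun j N => hB _ _).
by apply: (cvgC_near_eq (N := 0%N)) h => N _; rewrite rhs_term1_partial_sum.
Qed.

Lemma rhs_term2_cvg : (fun N => \sum_(0 <= n < N) rhs_term2 m.+2 q z n) @ \oo -->
  - sum_from 1 (fun j => B1 j * (theta_lim q z (3 * j - 1) - q ^+ (3 * j - 1))).
Proof.
have [B B_ge0 hB] := theta_tail_bounded.
have h := bailey_tannery (s := 1%N)
  (f := fun j N => theta_sum q z (3 * j - 1) (N - (3 * j - 1)) - q ^+ (3 * j - 1)) B_ge0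
  norm_bailey_coef1 (fun j => theta_tail_cvg (r := (3 * j - 1)%N)) (fun j N => hB _ _).
by apply: (cvgC_near_eq (N := 0%N)) (cvgCN h) => N _; rewrite rhs_term2_partial_sum.
Qed.

(** The last two series of the identity collect the leading terms [q^r] of the partial theta series,
    for [r = 3j] here and [r = 3j - 1] in [rhs_term4E]. *)
Lemma rhs_term3E j : rhs_term3 m.+2 q j = B0 j * q ^+ (3 * j).
Proof.
rewrite /rhs_term3 /bailey_coef0 -exprD; congr (_ ^+ _).
have : (2 * j <= 3 * j ^ 2)%N by nia.
nia.
Qed.

Lemma rhs_term4E j : (1 <= j)%N -> rhs_term4 m.+2 q j = B1 j * q ^+ (3 * j - 1).
Proof.
move=> j1; rewrite /rhs_term4 /bailey_coef1 -exprD; congr (_ ^+ _).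
have : (4 * j <= 3 * j ^ 2 + 1)%N by nia.
nia.
Qed.

Lemma coef_summable s (b c : nat -> C) (B : C) : 0 <= B ->
  (forall j, (s <= j)%N -> `|b j| <= `|q| ^+ j) -> (forall j, `|c j| <= B) ->
  summable_from s (fun j => b j * c j).
Proof.
move=> B_ge0 hb hc; apply: (cvg_of_geometric_terms (ltW q_gt0) q_lt1 B_ge0) => j sj.
rewrite normrM mulrC; apply: ler_pM; rewrite ?normr_ge0 //; first exact: hc.
exact: hb.
Qed.

Lemma sum_from_split s (b c d : nat -> C) (B B' : C) : 0 <= B -> 0 <= B' ->
  (forall j, (s <= j)%N -> `|b j| <= `|q| ^+ j) ->
  (forall j, `|c j - d j| <= B) -> (forall j, `|d j| <= B') ->
  sum_from s (fun j => b j * c j)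
  = sum_from s (fun j => b j * (c j - d j)) + sum_from s (fun j => b j * d j).
Proof.
move=> B_ge0 B_ge0' hb hc hd.
have h := cvgCD (coef_summable B_ge0 hb hc) (coef_summable B_ge0' hb hd).
apply: limCE; apply: (cvgC_near_eq (N := 0%N)) h => N _.
by rewrite -big_split /=; apply: eq_bigr => j _; rewrite -mulrDr subrK.
Qed.

Lemma norm_expq i : `|q ^+ i| <= 1.
Proof. by rewrite normrX exprn_ile1 // ltW. Qed.

Lemma theta_lim_tail_bounded :
  exists2 B : C, 0 <= B & forall r, `|theta_lim q z r - q ^+ r| <= B.
Proof.
have [B B_ge0 hB] := theta_tail_bounded; exists B => // r.
exact: norm_lim_le (theta_tail_cvg (r := r)) (fun N => hB r (N - r)%N).
Qed.

Lemma summable_rhs_term3 : summable_from 0 (rhs_term3 m.+2 q).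
Proof.
have -> : rhs_term3 m.+2 q = (fun j => B0 j * q ^+ (3 * j)).
  by apply/funext => j; exact: rhs_term3E.
exact: (coef_summable ler01 (fun j _ => norm_bailey_coef0 j) (fun j => norm_expq _)).
Qed.

Lemma rhs_term4_partial_sum : (fun N => \sum_(1 <= j < N) rhs_term4 m.+2 q j)
  = (fun N => \sum_(1 <= j < N) B1 j * q ^+ (3 * j - 1)).
Proof.
by apply/funext => N; apply: eq_big_nat => j /andP[j1 _]; exact: rhs_term4E.
Qed.

Lemma summable_rhs_term4 : summable_from 1 (rhs_term4 m.+2 q).
Proof.
rewrite /summable_from rhs_term4_partial_sum.
exact: (coef_summable ler01 norm_bailey_coef1 (fun j => norm_expq _)).
Qed.

(** Each theta value is split into its leading term [q^r] and the rest: the rests are the two double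
    series, the leading terms the two single ones. *)
Lemma lhs_limit :
  sum_from 0 (fun j => B0 j * theta_lim q z (3 * j))
  - sum_from 1 (fun j => B1 j * theta_lim q z (3 * j - 1))
  = sum_from 0 (rhs_term1 m.+2 q z) + sum_from 0 (rhs_term2 m.+2 q z)
    + sum_from 0 (rhs_term3 m.+2 q) - sum_from 1 (rhs_term4 m.+2 q).
Proof.
have [B B_ge0 hB] := theta_lim_tail_bounded.
rewrite (sum_from_split B_ge0 ler01 (fun j _ => norm_bailey_coef0 j)
  (fun j => hB (3 * j)%N) (fun j => norm_expq (3 * j))).
rewrite (sum_from_split B_ge0 ler01 norm_bailey_coef1
  (fun j => hB (3 * j - 1)%N) (fun j => norm_expq (3 * j - 1))).
rewrite -(limCE rhs_term1_cvg) -[X in - (X + _)]opprK -(limCE rhs_term2_cvg).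
rewrite -(_ : rhs_term3 m.+2 q = (fun j => B0 j * q ^+ (3 * j))); last first.
  by apply/funext => j; exact: rhs_term3E.
rewrite [X in - (_ + X)]/sum_from -rhs_term4_partial_sum /sum_from.
move: (limn _) (limn _) (limn _) (limn _) => a b c d; ring.
Qed.

Lemma lhs_sum_cvg : (fun N => \sum_(0 <= n < N) lhs_term m.+2 q z n) @ \oo -->
  W^-1 * (sum_from 0 (rhs_term1 m.+2 q z) + sum_from 0 (rhs_term2 m.+2 q z)
    + sum_from 0 (rhs_term3 m.+2 q) - sum_from 1 (rhs_term4 m.+2 q)).
Proof.
have h := lhs_cvg; rewrite lhs_limit in h.
apply: (cvgC_near_eq (N := 0%N)) (cvgCMl (a := W^-1) h) => N _.
by rewrite mulKf // theta_const_neq0.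
Qed.

End HeckeSums.

(** * Convergence of all the series, and the identity *)

Theorem theorem1p3 (R : realType) (q z : R[i]) (k : nat)
    (hq0 : 0 < `|q|) (hq1 : `|q| < 1) (hz0 : z != 0)
    (hz : forall m : int, m != 0 -> z != q ^ m) (hk : (2 <= k)%N) :
  [/\ summable_from 0 (lhs_term k q z),
      summable_from 0 (rhs_term1 k q z),
      summable_from 0 (rhs_term2 k q z),
      summable_from 0 (rhs_term3 k q) /\ summable_from 1 (rhs_term4 k q)
    & qpoch_inf (z * q) q * qpoch_inf (z^-1 * q) q * qpoch_inf q q
        * sum_from 0 (lhs_term k q z)
      = sum_from 0 (rhs_term1 k q z) + sum_from 0 (rhs_term2 k q z)
        + sum_from 0 (rhs_term3 k q) - sum_from 1 (rhs_term4 k q)].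
Proof.
case: k hk => [|[|m]] // _.
have hl := lhs_sum_cvg (m := m) hq0 hq1 hz0 hz.
split.
- exact: cvgP hl.
- exact: cvgP (rhs_term1_cvg (m := m) (z := z) hq0 hq1 hz0).
- exact: cvgP (rhs_term2_cvg (m := m) (z := z) hq0 hq1 hz0).
- split; first exact: (summable_rhs_term3 hq0 hq1 hz0).
  exact: (summable_rhs_term4 hq0 hq1 hz0).
rewrite [sum_from 0 (lhs_term _ _ _)](limCE hl) -/(theta_const q z) mulVKf //.
exact: theta_const_neq0.
Qed.
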